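(* Let $\tau$ be an infinite cardinal, let $P$ and $K$ be proper closed subsets of $D^\tau$, and let $f:P\to K$ be a homeomorphism. Suppose that $\mathfrak{L}_P^d$ is discrete in $\mathfrak{L}_P$ and that $f(P^{(\lambda)})=K^{(\lambda)}$ for every cardinal $\lambda$. Then $f$ can be extended to a homeomorphism of $D^\tau$ onto itself.
   Context: $D^\tau$ is the Cantor discontinuum (Cantor cube) of weight $\tau$, i.e. the product of $\tau$ copies of the two-point discrete space $D=\{0,1\}$. For an infinite cardinal $\lambda$, a $G_\lambda$-subset of a space is an intersection of at most $\lambda$ open sets. For a space $X$, a subset $P\subset X$ and an infinite cardinal $\lambda$, the $\lambda$-interior $P^{(\lambda)}$ of $P$ in $X$ is the set of all $x\in P$ such that there exists a $G_\lambda$-subset $H$ of $X$ with $x\in H\subset P$. If $\lambda$ is finite, $P^{(\lambda)}$ is the ordinary interior of $P$ in $X$, also denoted $P^{(0)}$. Here all $\lambda$-interiors of $P$ and $K$ are taken in $X=D^\tau$. $\mathfrak{L}_P$ denotes the set of all cardinals $\lambda$ with $P^{(\lambda)}\neq\varnothing$. Let $\lambda\in\mathfrak{L}_P$ be an (infinite) limit cardinal. $\mathfrak{L}_P$ is discontinuous at $\lambda$ if $\overline{\bigcup_{\gamma<\lambda}P^{(\gamma)}}\subsetneqq P^{(\lambda)}$ (the union over cardinals $\gamma<\lambda$), and otherwise it is continuous at $\lambda$. $\mathfrak{L}_P^d$ denotes the set of cardinals $\lambda\in\mathfrak{L}_P$ at which $\mathfrak{L}_P$ is discontinuous. The set $\mathfrak{L}_P^d$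 is said to be discrete in $\mathfrak{L}_P$ if for every $\lambda\in\mathfrak{L}_P^d$ there is a cardinal $\gamma<\lambda$ such that the interval of cardinals $(\gamma,\lambda)$ is disjoint from $\mathfrak{L}_P^d$. *)

(* Defs.v *)
From HB Require Import structures.
From mathcomp Require Import all_boot all_order all_algebra.
From mathcomp Require Import all_classical all_reals all_analysis.

Set Implicit Arguments.
Unset Strict Implicit.
Unset Printing Implicit Defensive.

Local Open Scope classical_set_scope.
Local Open Scope card_scope.

(* A cardinal is represented by any type of that cardinality; everything below
   depends on such a type only up to equipotence. A single universe level is
   used for the weight of the cube and for all the cardinals quantified over,
   so that every cardinal up to the weight (and beyond) is available. *)
Definition cardinal := Type.

Definition finite_cardinal (a : cardinal) : Prop := finite_set [set: a].

Definition infinite_cardinal (a : cardinal) : Prop := ~ finite_cardinal a.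

Definition cardinal_lt (a b : cardinal) : Prop :=
  [set: a] #<= [set: b] /\ ~ ([set: b] #<= [set: a]).

(* In particular aleph_0 is a limit cardinal. *)
Definition limit_cardinal (a : cardinal) : Prop :=
  infinite_cardinal a /\
  forall b : cardinal, cardinal_lt b a ->
    exists c : cardinal, cardinal_lt b c /\ cardinal_lt c a.

Definition cantor_cube (tau : cardinal) : topologicalType :=
  prod_topology (fun _ : tau => bool).

Definition G_subset (X : topologicalType) (lambda : cardinal) (H : set X)
    : Prop :=
  exists F : set (set X),
    [/\ F #<= [set: lambda],
        forall U, F U -> open U
      & H = \bigcap_(U in F) U].

Definition card_interior (X : topologicalType) (P : set X) (lambda : cardinal)
    : set X :=
  [set x | if `[< finite_cardinal lambda >] then P° x
           else P x /\ exists H : set X,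
                  [/\ G_subset lambda H, H x & H `<=` P]].

Definition L_set (X : topologicalType) (P : set X) (lambda : cardinal) : Prop :=
  card_interior P lambda !=set0.

Definition lower_union (X : topologicalType) (P : set X) (lambda : cardinal)
    : set X :=
  [set x | exists gamma : cardinal,
             cardinal_lt gamma lambda /\ card_interior P gamma x].

Definition L_discontinuous (X : topologicalType) (P : set X)
    (lambda : cardinal) : Prop :=
  [/\ L_set P lambda, limit_cardinal lambda
    & closure (lower_union P lambda) `<` card_interior P lambda].

Definition Ld_discrete (X : topologicalType) (P : set X) : Prop :=
  forall lambda : cardinal, L_discontinuous P lambda ->
    exists gamma : cardinal, cardinal_lt gamma lambda /\
      forall mu : cardinal, cardinal_lt gamma mu -> cardinal_lt mu lambda ->
        ~ L_discontinuous P mu.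

(* [f] is a total function, but only its restriction to [A] is relevant. *)
Definition homeomorphism_between (X Y : topologicalType) (A : set X) (B : set Y)
    (f : X -> Y) : Prop :=
  exists g : Y -> X,
    [/\ forall x, A x -> B (f x) /\ g (f x) = x,
        forall y, B y -> A (g y) /\ f (g y) = y,
        {within A, continuous f}
      & {within B, continuous g}].

(* Main.v *)
(* For a set [D] of coordinates write [x]_D for the set of points agreeing with
   [x] on [D]. For infinite [lambda], [x] is in the [lambda]-interior of [P] iff
   [x]_D is contained in [P] for some [D] of size at most [lambda]; a closing-off
   argument shows that one set of at most [lambda] coordinates serves all such
   [x]. Since every coordinate of [f] depends on finitely many coordinates, [f]
   can be extended along an increasing chain of sets [N] of coordinates, adding
   countably many at a time: given an autohomeomorphism of [D^N] compatible with
   [f], one extends it to [N U M] by a back-and-forth construction on clopen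
   sets, as in the Knaster-Reichbach theorem (which is the first step, [N] empty).
   The later steps work because, if [N] determines the [|N|]-interiors of [P] and
   [K] and [M] is closed under countably many operations, the fibers of [P] over
   a point of [D^(M n N)] are everything when the point comes from the
   [|N|]-interior, and nowhere dense otherwise.
   It remains to build the chain so that its member of size [lambda] determines
   the [lambda]-interior. At a limit cardinal where [L_P] is continuous this is
   automatic; the remaining cardinals (successors and discontinuities) are
   left-discrete, successors trivially and discontinuities by hypothesis, so
   along the chain only two of them have to be prepared at a time. *)
From Stdlib Require List.
Require Import Defs.
From mathcomp Require Import all_boot all_order all_algebra.
From mathcomp Require Import wochoice.
From mathcomp Require Import all_classical all_reals all_analysis.

Local Open Scope classical_set_scope.
Local Open Scope card_scope.

Set Implicit Arguments.
Unset Strict Implicit.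
Unset Printing Implicit Defensive.

(** * Finitely supported functions and compactness *)

(** The obstacle is the bookkeeping. A set determining the $|k|$-interior may need $|k|$
    coordinates, all of which must be present before stage $k$, while a back-and-forth step
    enumerates its demands and so adds only countably many. A stage lies below many cardinals $k$
    and cannot serve all of them. Left-discreteness assigns to each $k$ a tail $[g_k, k)$ of stages:
    it still has $|k|$ elements, and the tails of different $k$ are disjoint, so a stage receives at
    most one coordinate from each of the two families of prepared cardinals. Points of continuity
    need no preparation because the tubes over a fixed set of coordinates form a closed set, which
    contains the closure of the lower interiors as soon as it contains these. Continuity is known
    for [P] only; for [K] it is transported by [f]. The stages follow a well-order whose type is an
    initial ordinal. Hence every proper stage leaves infinitely many coordinates free, and these are
    used to split clopen sets that miss [P] or [K]. *)

Definition agree (I : Type) (D : set I) (x y : I -> bool) : Prop :=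
  forall i, D i -> x i = y i.

Definition mix (I : Type) (D : set I) (x y : I -> bool) : I -> bool :=
  fun i => if `[< D i >] then x i else y i.

(** For discrete [A] these are the continuous maps on the cube that depend on coordinates in [V]
    only; with [A] equal to [bool] they stand for clopen sets. *)
Definition fsupp (I A : Type) (V : set I) (h : (I -> bool) -> A) : Prop :=
  exists D, [/\ finite_set D, D `<=` V & forall x y, agree D x y -> h x = h y].

Definition cclosed (I : Type) (P : set (I -> bool)) : Prop :=
  forall x, ~ P x -> exists2 D, finite_set D & forall y, agree D x y -> ~ P y.

Lemma agree_sym (I : Type) (D : set I) (x y : I -> bool) :
  agree D x y -> agree D y x.
Proof. by move=> h i Di; rewrite h. Qed.

Lemma agree_trans (I : Type) (D : set I) (y x z : I -> bool) :
  agree D x y -> agree D y z -> agree D x z.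
Proof. by move=> h h' i Di; rewrite h// h'. Qed.

Lemma agree_sub (I : Type) (D E : set I) (x y : I -> bool) :
  D `<=` E -> agree E x y -> agree D x y.
Proof. by move=> DE h i /DE; exact: h. Qed.

Lemma mix_in (I : Type) (D : set I) (x y : I -> bool) : agree D (mix D x y) x.
Proof. by move=> i Di; rewrite /mix asboolT. Qed.

Lemma mix_out (I : Type) (D E : set I) (x y : I -> bool) :
  (forall i, E i -> ~ D i) -> agree E (mix D x y) y.
Proof. by move=> h i /h nD; rewrite /mix asboolF. Qed.

Lemma agree_mix (I : Type) (D E : set I) (x y z : I -> bool) :
  agree (E `&` D) x z -> agree (E `\` D) y z -> agree E (mix D x y) z.
Proof.
by move=> h h' i Ei; rewrite /mix; case: asboolP => Di; [exact: h|exact: h'].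
Qed.

Lemma fsuppW (I A : Type) (V W : set I) (h : (I -> bool) -> A) :
  V `<=` W -> fsupp V h -> fsupp W h.
Proof. by move=> VW [D [fD DV hD]]; exists D; split=> //; apply: subset_trans VW. Qed.

Lemma finite_setP_In (I : Type) (D : set I) :
  finite_set D -> exists l : seq I, forall i, D i <-> List.In i l.
Proof.
move=> fD; have /finite_seqP[s Ds] : finite_set (D : set {classic I}) by [].
exists (s : seq {classic I}) => i; rewrite Ds /=.
elim: (s) => [|j t IH] /=; first by rewrite in_nil.
rewrite in_cons; split=> [/orP[/eqP->|/IH]|[->|/IH]]; first by left.
- by right.
- by rewrite eqxx.
- by move=> ->; rewrite orbT.
Qed.

Lemma finite_set_In (I : Type) (l : seq I) : finite_set [set i | List.In i l].
Proof.
elim: l => [|i l IH]; first by rewrite (_ : mkset _ = set0)// predeqE.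
rewrite (_ : mkset _ = [set i] `|` [set j | List.In j l]); last first.
  by rewrite predeqE => j; split=> -[->|?]; [left|right|left|right].
by rewrite finite_setU.
Qed.

Lemma finite_setI2 (I : Type) (D E : set I) : finite_set D -> finite_set (D `&` E).
Proof. by apply: sub_finite_set => i []. Qed.


Lemma nbhs_agree (I : Type) (D : set I) (x : cantor_cube I) :
  finite_set D -> nbhs x [set y : cantor_cube I | agree D x y].
Proof.
move=> /finite_setP_In[l Dl].
suff : nbhs x [set y : cantor_cube I | agree [set i | List.In i l] x y].
  by apply: filterS => y h i /Dl; exact: h.
elim: l {D Dl} => [|i l IH]; first by apply: filterE => y j [].
have hi : nbhs x [set y : cantor_cube I | x i = y i].
  have := @proj_continuous {classic I} (fun=> bool) i x.
  by move=> /(_ [set b | x i = b]); apply; move=> b /= ->.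
by apply: filterS2 IH hi => y h1 h2 j [<-|/h1].
Qed.

Lemma nbhs_agreeP (I : Type) (x : cantor_cube I) (U : set (cantor_cube I)) :
  nbhs x U -> exists2 D : set I, finite_set D & forall y, agree D x y -> U y.
Proof.
pose F : set_system (cantor_cube I) :=
  [set A | exists2 D : set I, finite_set D & forall y, agree D x y -> A y].
have FF : Filter F.
  split=> [|A B [D fD hA] [E fE hB]|A B AB [D fD hA]].
  - by exists set0.
  - exists (D `|` E); first by rewrite finite_setU.
    move=> y h; split; [apply: hA|apply: hB]; apply: agree_sub h; [left|right];
    exact.
  - by exists D => // y /hA /AB.
suff : F --> x by apply.
(* The product topology is a supremum of weak topologies, so convergence is checked one coordinate
   at a time. *)
apply/cvg_sup => i V [W] [[U1] openU1 <-] Ux WV.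
exists [set i]; first exact: finite_set1.
by move=> y /(_ i erefl) xy; apply: WV; rewrite /= -xy.
Qed.

Lemma closed_cclosed (I : Type) (P : set (cantor_cube I)) :
  closed P -> @cclosed I P.
Proof.
move=> cP x nPx; have /nbhs_agreeP[D fD h] : nbhs (x : cantor_cube I) (~` P).
  by apply: open_nbhs_nbhs; split => //; exact: closed_openC.
by exists D.
Qed.

(** If no finite list works, the sets of points served by no label of a finite list generate a
    proper filter; a cluster point of it has a label that serves a whole neighbourhood. *)
Lemma cube_compact (I B : Type) (R : (I -> bool) -> B -> Prop) :
  (forall x, exists b D, finite_set D /\ forall y, agree D x y -> R y b) ->
  exists s : seq B, forall x, exists2 b, List.In b s & R x b.
Proof.
move=> hR; apply: contrapT => /forallNP ns.
have {}ns (s : seq B) : exists x, forall b, List.In b s -> ~ R x b.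
  have /existsNP[x nx] := ns s; exists x => b bs Rxb; apply: nx; by exists b.
pose F : set_system (cantor_cube I) := [set A | exists s : seq B,
  forall x : I -> bool, (forall b, List.In b s -> ~ R x b) -> A x].
have FF : ProperFilter F.
  apply: Build_ProperFilter_ex => [A [s sA]|].
    by have [x nx] := ns s; exists x; apply: sA.
  split=> [|A A' [s hA] [s' hB]|A A' AB [s hA]].
  - by exists [::].
  - exists (s ++ s') => x hx; split; [apply: hA|apply: hB] => b bs; apply: hx;
    apply/List.in_app_iff; [left|right]; exact: bs.
  - by exists s => x /hA /AB.
have cpt : compact [set: cantor_cube I].
  have := @tychonoff {classic I} (fun _ => bool) _ (fun=> bool_compact).
  by congr (compact _); rewrite eqEsubset.
have [x [_ clx]] := cpt F FF filterT.
have [b [D [fD hD]]] := hR x.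
have [|y [/= ny /hD //]] := clx [set y | ~ R y b] _ _ (nbhs_agree x fD).
exists [:: b] => y hy; apply: hy; by left.
Qed.

(** A choice function that is locally constant: by compactness finitely many of the local choices
    suffice. *)
Lemma select (I B : Type) (V : set I) (R : (I -> bool) -> B -> Prop) :
  (forall x, exists b D, [/\ finite_set D, D `<=` V
     & forall y, agree D x y -> R y b]) ->
  exists2 h : (I -> bool) -> B, fsupp V h & forall x, R x (h x).
Proof.
move=> hR; have [b0 _] := hR (fun=> true).
pose T : Type := B * set I * (I -> bool).
pose st (t : T) := [/\ finite_set t.1.2, t.1.2 `<=` V
                     & forall y, agree t.1.2 t.2 y -> R y t.1.1].
have [|s hs] := @cube_compact I T
    (fun y (t : T) => st t /\ agree t.1.2 t.2 y).
  move=> x; have [b [D [fD DV hD]]] := hR x.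
  by exists (b, D, x), D; split.
suff [h fh hh] : exists2 h : (I -> bool) -> B, fsupp V h & forall x,
    (exists2 t : T, List.In t s & st t /\ agree t.1.2 t.2 x) -> R x (h x).
  by exists h => // x; apply: hh; exact: hs.
elim: s {hs} => [|t s [h [D [fD DV hD]] hh]].
  by exists (fun=> b0) => [|x []//]; exists set0; split.
have [stt|nst] := pselect (st t); last first.
  exists h => [|x [t' [<- []//|ts] ?]]; first by exists D.
  by apply: hh; exists t'.
have [ft tV ht] := stt.
(* The first valid condition in the list that [x] meets decides the value. *)
exists (fun x => if `[< agree t.1.2 t.2 x >] then t.1.1 else h x).
  exists (t.1.2 `|` D); split; first by rewrite finite_setU.
    by rewrite subUset.
  move=> x y xy; rewrite (hD x y); last by apply: agree_sub xy; right.
  have axy : agree t.1.2 x y by apply: agree_sub xy; left.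
  have -> // : agree t.1.2 t.2 x = agree t.1.2 t.2 y.
  apply/propext; split=> h'; apply: (agree_trans h') => //.
  exact: agree_sym.
move=> x [t' h1 h2]; case: asboolP => [/ht//|na].
by apply: hh; exists t' => //; case: h1 => // tt'; case: na; rewrite tt'; apply h2.
Qed.

Lemma fsupp_local (I A : Type) (V : set I) (h : (I -> bool) -> A) :
  (forall x, exists D, [/\ finite_set D, D `<=` V
     & forall y, agree D x y -> h y = h x]) ->
  fsupp V h.
Proof.
move=> hh; have [|h' fh' e] := @select I A V (fun x b => h x = b).
  by move=> x; have [D [fD DV hD]] := hh x; exists (h x), D; split.
by have -> : h = h' by apply/funext.
Qed.

(** The projection of a closed set to the coordinates in [V] is closed. In the cover, [None] serves
    the points off [Z] and [Some i] those that differ from [w] at [i]. *)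
Lemma separation (I : Type) (V : set I) (Z : set (I -> bool)) (w : I -> bool) :
  cclosed Z -> (forall z, Z z -> ~ agree V w z) ->
  exists D, [/\ finite_set D, D `<=` V & forall z, agree D w z -> ~ Z z].
Proof.
move=> cZ hZ.
have [|s hs] := @cube_compact I (option I) (fun z b =>
    if b is Some i then V i /\ w i <> z i else ~ Z z).
  move=> x; have [Zx|/cZ[D fD hD]] := pselect (Z x); last by exists None, D.
  have /existsNP[i /not_implyP[Vi wx]] := hZ _ Zx.
  exists (Some i), [set i]; split; first exact: finite_set1.
  by move=> y /(_ i erefl) <-.
exists (V `&` [set i | List.In (Some i) s]); split.
- apply: (@sub_finite_set _ _ [set i | List.In i (pmap id s)]); last first.
    exact: finite_set_In.
  move=> i [_] /=; elim: (s) => [//|[j|] t IH] /=.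
    by case=> [[->]|/IH ?]; [left|right].
  by case=> [//|/IH].
- by move=> i [].
- move=> z wz; have [[i|//] ins [Vi]] := hs z.
  by rewrite (wz i).
Qed.

(** * Cardinal arithmetic *)

(* [A] has cardinality at most [L]; the [option] allows [I] or [A] to be empty. *)
Definition covers (L I : Type) (A : set I) : Prop :=
  exists e : L -> option I, forall a, A a -> exists l, e l = Some a.

(* Equivalent to [L] being infinite, see [squarable_infinite]. *)
Definition squarable (L : Type) : Prop :=
  exists s : L -> seq L, forall l, exists x, s x = l.

Lemma covers_sub (L I : Type) (A B : set I) :
  A `<=` B -> covers L B -> covers L A.
Proof. by move=> AB [e he]; exists e => a /AB /he. Qed.

Lemma covers_trans (L M I : Type) (A : set I) :
  covers L [set: M] -> covers M A -> covers L A.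
Proof.
move=> [e he] [d hd]; exists (fun l => if e l is Some m then d m else None).
by move=> a /hd[m <-]; have [//|l el] := he m; exists l; rewrite el.
Qed.

Lemma covers_image (L I J : Type) (f : I -> J) (A : set I) :
  covers L A -> covers L (f @` A).
Proof.
move=> [e he]; exists (fun l => omap f (e l)) => _ [a /he[l el] <-].
by exists l; rewrite el.
Qed.

Lemma covers_relP (L I : Type) (A : set I) (R : I -> L -> Prop) :
  (forall a, A a -> exists l, R a l) ->
  (forall a b l, A a -> A b -> R a l -> R b l -> a = b) ->
  covers L A.
Proof.
move=> hR iR; have /choice[e he] (l : L) : exists o : option I,
    forall a, A a -> R a l -> o = Some a.
  have [[a [Aa Ra]]|n] := pselect (exists a, A a /\ R a l).
    by exists (Some a) => b Ab Rb; rewrite (iR a b l).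
  by exists None => a Aa Ra; case: n; exists a.
by exists e => a Aa; have [l Ral] := hR _ Aa; exists l; apply: he.
Qed.

Lemma covers_cardP (L I : Type) (A : set I) :
  covers L A <-> A #<= [set: L].
Proof.
split=> [[e he]|/card_leP[f]].
  have /choice[d hd] (a : A) : exists l, e l = Some (val a).
    by apply: he; exact: set_valP.
  apply/card_leP/injfunPex; exists (fun a => to_setT (d a)) => //.
  move=> a b _ _ /(congr1 val) /= dab; apply: val_inj.
  have := hd a; rewrite (_ : d a = d b) ?hd; first by case.
  exact: dab.
apply: (@covers_relP _ _ _ (fun a l => exists Aa : A a,
    val (f (SigSub (mem_set Aa))) = l)).
  by move=> a Aa; eexists; exists Aa.
move=> a b l Aa Ab [Aa' <-] [Ab' /val_inj /esym h].
by have [] := @inj _ _ _ f _ _ (in_setT _) (in_setT _) h.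
Qed.

Lemma squarable_nat : squarable nat.
Proof.
exists (fun n => odflt [::] (choice.unpickle n)) => l.
by exists (choice.pickle l); rewrite choice.pickleK.
Qed.

Lemma covers_nat (L : Type) : squarable L -> covers L [set: nat].
Proof.
move=> [s hs]; have [x0 _] := hs [::]; exists (fun l => Some (size (s l))).
by move=> n _; have [l sl] := hs (nseq n x0); exists l; rewrite sl size_nseq.
Qed.

Lemma covers_countable (L I : Type) (A : set I) :
  squarable L -> covers nat A -> covers L A.
Proof. by move=> /covers_nat; exact: covers_trans. Qed.

Lemma covers_finite (L I : Type) (A : set I) :
  squarable L -> finite_set A -> covers L A.
Proof.
move=> sL fA; apply: covers_countable => //.
have [l Al] := finite_setP_In fA; exists (fun n => nth None (map Some l) n).
move=> a /Al; elim: l {Al} => //= i l IH [->|/IH[n e]]; first by exists 0.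
by exists n.+1.
Qed.

Lemma covers_bigcup (L I J : Type) (X : set J) (A : J -> set I) :
  squarable L -> covers L X -> (forall j, X j -> covers L (A j)) ->
  covers L (\bigcup_(j in X) A j).
Proof.
move=> [s hs] [e he] hA.
have /choice[d hd] (j : J) : exists d : L -> option I,
    X j -> forall a, A j a -> exists l, d l = Some a.
  have [Xj|nX] := pselect (X j); last by exists (fun=> None).
  by have [d hd] := hA _ Xj; exists d.
(* Lists of length two serve as pairs, so this is the inequality $L \cdot L \le L$. *)
exists (fun l => if s l is [:: l1; l2] then
                   if e l1 is Some j then d j l2 else None else None).
move=> a [j Xj Aja]; have [l1 el1] := he _ Xj; have [l2 dl2] := hd _ Xj _ Aja.
by have [l sl] := hs [:: l1; l2]; exists l; rewrite sl el1.
Qed.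

Lemma coversU (L I : Type) (A B : set I) :
  squarable L -> covers L A -> covers L B -> covers L (A `|` B).
Proof.
move=> sL cA cB; apply: (@covers_sub _ _ _
    (\bigcup_(b in [set: bool]) if b then A else B)).
  by move=> a [Aa|Ba]; [exists true|exists false].
apply: covers_bigcup => // [|[]//].
by apply: covers_finite => //; exact: finite_finset.
Qed.

Lemma covers_seq (L I : Type) (B : set I) : squarable L -> covers L B ->
  covers L [set l : seq I | forall i, List.In i l -> B i].
Proof.
move=> [s hs] [e he]; exists (fun l => Some (pmap e (s l))) => l /= hl.
suff [x <-] : exists x : seq L, pmap e x = l by have [y <-] := hs x; exists y.
elim: l hl => [|i l IH] hl; first by exists [::].
have [x xl] := IH (fun j jl => hl j (or_intror jl)).
have [y ey] := he i (hl i (or_introl erefl)).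
by exists (y :: x) => /=; rewrite ey /= xl.
Qed.

(** [Q] must tolerate every [y] that agrees with [x] on [D], so a demand is given by an element of
    [J], a finite list of coordinates and a list of bits. There are at most [L] of them over a set
    of size [L], and $\omega$ rounds close it off. *)
Lemma closing_off (L I J : Type) (M0 : set I)
    (Q : J -> set I -> (I -> bool) -> set I -> Prop) :
  squarable L -> covers L [set: J] -> covers L M0 ->
  (forall j D x, finite_set D ->
     exists2 E, covers L E & forall y, agree D x y -> Q j D y E) ->
  exists M, [/\ M0 `<=` M, covers L M & forall j D y, finite_set D -> D `<=` M ->
    exists2 E, E `<=` M & Q j D y E].
Proof.
move=> sL cJ cM0 hQ.
have /choice[op hop] (t : J * seq I * seq bool) : exists E : set I,
    covers L E /\ forall D y, (forall i, D i <-> List.In i t.1.2) ->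
      map y t.1.2 = t.2 -> Q t.1.1 D y E.
  case: t => [[j l] b] /=.
  have fl := finite_set_In l.
  (* Bits that no point realizes, for instance by a wrong length, demand nothing. *)
  have [[x xl]|nx] := pselect (exists x : I -> bool, map x l = b); last first.
    exists set0; split; first by apply: covers_finite.
    by move=> D y _ h; case: nx; exists y.
  have [E cE hE] := hQ j _ x fl; exists E; split => // D y Dl yl.
  have -> : D = [set i | List.In i l] by apply/seteqP; split=> i /Dl.
  apply: hE => i /=; move: xl; rewrite -{b}yl.
  by elim: l {fl Dl} => //= k l IH [xk /IH h] [<-|/h].
pose next M := M `|` \bigcup_(t in [set t : J * seq I * seq bool |
   forall i, List.In i t.1.2 -> M i]) op t.
pose Mn n := iter n next M0.
have Mmono n m : (n <= m)%N -> Mn n `<=` Mn m.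
  elim: m => [|m IH]; first by rewrite leqn0 => /eqP ->.
  by rewrite leq_eqVlt => /orP[/eqP->//|/IH h i /h ?]; left.
have cMn n : covers L (Mn n).
  elim: n => //= n IH; apply: coversU => //.
  apply: covers_bigcup => // [|t _]; last by have [] := hop t.
  apply: (@covers_sub _ _ _ (\bigcup_(j in [set: J])
     \bigcup_(b in [set: seq bool])
     ((fun l => (j, l, b)) @` [set l | forall i, List.In i l -> Mn n i]))).
    by move=> [[j l] b] /= h; exists j => //; exists b => //; exists l.
  apply: covers_bigcup => // j _; apply: covers_bigcup => // [|b _].
    apply: covers_countable => //; exists (@choice.unpickle (seq bool)) => b _.
    by exists (choice.pickle b); rewrite choice.pickleK.
  by apply: covers_image; apply: covers_seq.
exists (\bigcup_n Mn n); split.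
- by move=> i M0i; exists 0.
- by apply: covers_bigcup => //; exact: covers_nat.
move=> j D y fD DM; have [l Dl] := finite_setP_In fD.
have [n hn] : exists n, forall i, List.In i l -> Mn n i.
  have : forall i, List.In i l -> exists n, Mn n i.
    by move=> i /Dl/DM[n _ ?]; exists n.
  elim: l {Dl} => [|i l IH] h; first by exists 0.
  have [n hn] := IH (fun k kl => h k (or_intror kl)).
  have [m hm] := h i (or_introl erefl); exists (maxn n m) => k [<-|/hn].
    by apply: Mmono hm; exact: leq_maxr.
  by apply: Mmono; exact: leq_maxl.
have [_ hE] := hop (j, l, map y l); exists (op (j, l, map y l)); last first.
  by apply: hE.
by move=> i oi; exists n.+1 => //; right; exists (j, l, map y l).
Qed.

(** A maximal partial injection leaves no pair of unmatched points, one on each side, since that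
    pair could be added. *)
Lemma covers_total (A B : Type) : covers A [set: B] \/ covers B [set: A].
Proof.
pose P : set (set (A * B)) := [set G | forall p q, G p -> G q ->
  (p.1 = q.1 -> p.2 = q.2) /\ (p.2 = q.2 -> p.1 = q.1)].
have [|G [PG maxG]] := @Zorn_bigcup _ P.
  move=> F FP totF p q [X FX Xp] [Y FY Yq].
  by have [XY|YX] := totF _ _ FX FY; [apply: (FP _ FY) => //; apply: XY|
    apply: (FP _ FX) => //; apply: YX].
have [h|/existsNP[a na]] := pselect (forall a, exists b, G (a, b)).
  right; apply: (@covers_relP _ _ _ (fun a b => G (a, b))) => //.
  by move=> a a' b _ _ Ga Ga'; have [_ /(_ erefl)] := PG _ _ Ga Ga'.
left; apply: (@covers_relP _ _ _ (fun b a => G (a, b))) => [b _|].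
  apply: contrapT => nb; have : ~ (G `<` G `|` [set (a, b)]).
    move=> h; apply: (maxG _ h) => -[p1 p2] [q1 q2] [Gp|[-> ->]] [Gq|[-> ->]] //=.
    - exact: PG Gp Gq.
    - split=> e; [case: na; exists p2|case: nb; exists p1]; by rewrite -e.
    - split=> e; [case: na; exists q2|case: nb; exists q1]; by rewrite e.
  apply; rewrite properEneq; split; last by move=> p; left.
  apply/eqP => e; case: na; exists b; rewrite e; by right.
by move=> b b' a' _ _ Gb Gb'; have [/(_ erefl)] := PG _ _ Gb Gb'.
Qed.

Lemma covers_inj (L I : Type) (A : set I) (l0 : L) : covers L A ->
  exists f : I -> L, forall a b, A a -> A b -> f a = f b -> a = b.
Proof.
move=> [e he]; have /choice[f hf] (i : I) : exists l, A i -> e l = Some i.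
  by have [/he[l el]|nA] := pselect (A i); [exists l|exists l0].
exists f => a b Aa Ab fab; have := hf _ Aa.
by rewrite fab (hf _ Ab) => -[].
Qed.

Definition lists_in (L : Type) (A : set L) : set (seq L) :=
  [set l | forall i, List.In i l -> A i].

Lemma squarable_of_inj (L : Type) (l0 : L) (h : seq L -> L) :
  (forall a b, h a = h b -> a = b) -> squarable L.
Proof.
move=> ih; have [e he] : covers L [set: seq L].
  apply: (@covers_relP _ _ _ (fun a l => h a = l)) => [a _|]; first by exists (h a).
  by move=> a b l _ _ <- /ih.
exists (fun l => odflt [::] (e l)) => l.
by have [x ex] := he l I; exists x; rewrite ex.
Qed.

(** Blocks of the fixed length two keep the flattening injective. *)
Fixpoint dbl (L : Type) (p : L -> L * L) (l : seq L) : seq L :=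
  if l is x :: l' then (p x).1 :: (p x).2 :: dbl p l' else [::].

Lemma dbl_inj (L : Type) (B : set L) (p : L -> L * L) :
  (forall x y, B x -> B y -> p x = p y -> x = y) ->
  forall l l', lists_in B l -> lists_in B l' -> dbl p l = dbl p l' -> l = l'.
Proof.
move=> ip; elim=> [|x l IH] [|x' l'] //= Bl Bl' [e1 e2 e].
congr cons.
  apply: ip; [by apply: Bl; left|by apply: Bl'; left|].
  by rewrite [LHS]surjective_pairing [RHS]surjective_pairing e1 e2.
by apply: IH => // i il; [apply: Bl|apply: Bl']; right.
Qed.

Lemma dbl_in (L : Type) (A B : set L) (p : L -> L * L) :
  (forall x, B x -> A (p x).1 /\ A (p x).2) ->
  forall l, lists_in B l -> lists_in A (dbl p l).
Proof.
move=> hp; elim=> [_ i []|x l IH Bl i /= [<-|[<-|il]]].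
- by have [] := hp x (Bl x (or_introl erefl)).
- by have [] := hp x (Bl x (or_introl erefl)).
- by apply: IH il => j jl; apply: Bl; right.
Qed.

Lemma sval_inj (T : Type) (P : T -> Prop) (x y : {z | P z}) :
  sval x = sval y -> x = y.
Proof.
by case: x y => [x Px] [y Py] /= xy; subst y; rewrite (Prop_irrelevance Px Py).
Qed.

(* A maximal injection [seq A -> A] with [A] a subset of [L] lives on a set [A]
   equipotent to [L]: if [A] embeds into its complement by [th], a list over
   [A U th A] is coded by the [th]-image of the code of a list over [A]. *)
Lemma squarable_infinite (L : Type) : infinite_set [set: L] -> squarable L.
Proof.
move=> iL; have /infiniteP cL := iL.
have [nu nu_inj] : exists nu : nat -> L, forall m n, nu m = nu n -> m = n.
  have [l0 _] := infinite_setN0 iL.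
  have [nu h] := covers_inj l0 (proj2 (covers_cardP L [set: nat]) cL).
  by exists nu => m n; apply: h.
(* The two distinct elements are the tags that later separate [A] from its copy. *)
pose ok (t : set L * (seq L -> L)) := [/\ exists a b, [/\ t.1 a, t.1 b & a <> b],
   forall l, lists_in t.1 l -> t.1 (t.2 l) &
   forall l l', lists_in t.1 l -> lists_in t.1 l' -> t.2 l = t.2 l' -> l = l'].
pose T := {t | ok t}.
pose R (t u : T) := `[< (sval t).1 `<=` (sval u).1 /\
  forall l, lists_in (sval t).1 l -> (sval t).2 l = (sval u).2 l >].
have RP t u : reflect ((sval t).1 `<=` (sval u).1 /\
  forall l, lists_in (sval t).1 l -> (sval t).2 l = (sval u).2 l) (R t u).
  exact: asboolP.
have [t0 _] : exists t : T, True.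
  have [|nui hnui] := @choice _ _ (fun l n => range nu l -> nu n = l).
    by move=> l; have [[n _ <-]|h] := pselect (range nu l); [exists n|exists 0].
  have h : ok (range nu, fun l => nu (choice.pickle (map nui l))).
    split=> [|l _|l l' hl hl' /nu_inj /(pcan_inj choice.pickleK) e] /=.
    - by exists (nu 0), (nu 1); split; [exists 0|exists 1|move=> /nu_inj].
    - by exists (choice.pickle (map nui l)).
    - elim: l l' hl hl' e => [|x l IH] [|x' l'] //= hl hl' [e1 e2].
      congr cons; last first.
        by apply: IH => // i il; [apply: hl|apply: hl']; right.
      have := hnui _ (hl x (or_introl erefl)).
      by rewrite e1 hnui//; apply: hl'; left.
  by exists (exist _ _ h).
have [|||[[A phi] [/= [a0 [a1 [Aa0 Aa1 a01]]] phiA phi_inj]] maxA] :=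
    @ZL_preorder T t0 R.
- by move=> t; apply/RP; split.
- move=> r s t /RP[rs rs'] /RP[st st']; apply/RP; split.
    exact: subset_trans st.
  by move=> l hl; rewrite rs' // st' // => i /hl /rs.
- move=> C totC; have [[t1 Ct1]|nC] := pselect (exists t, C t); last first.
    by exists t0 => s Cs; case: nC; exists s.
  pose U := \bigcup_(t in C) (sval t).1.
  have lU l : lists_in U l -> exists2 t, C t & lists_in (sval t).1 l.
    elim: l => [|x l IH] h; first by exists t1.
    have [t Ct tl] := IH (fun i il => h i (or_intror il)).
    have [u Cu ux] := h x (or_introl erefl).
    have [/RP[tu _]|/RP[ut _]] := totC _ _ Ct Cu.
      by exists u => // i [<-//|/tl/tu].
    by exists t => // i [<-|/tl//]; apply: ut.
  have [psi hpsi] : exists psi : seq L -> L, forall t l, C t ->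
      lists_in (sval t).1 l -> psi l = (sval t).2 l.
    have [|psi h] := @choice _ _ (fun l x => forall t, C t ->
        lists_in (sval t).1 l -> x = (sval t).2 l); last by exists psi => *; apply: h.
    move=> l; have [[t [Ct tl]]|n] := pselect (exists t, C t /\ lists_in (sval t).1 l);
      last by exists (nu 0) => t Ct tl; case: n; exists t.
    exists ((sval t).2 l) => u Cu ul.
    by have [/RP[_ ->]|/RP[_ ->]] := totC _ _ Ct Cu.
  have h : ok (U, psi).
    split=> /=.
    - have [[a [b [ta tb ab]]] _ _] := svalP t1.
      by exists a, b; split=> //; exists t1.
    - move=> l /lU[t Ct tl]; exists t => //; rewrite (hpsi t)//.
      by have [_ + _] := svalP t; apply.
    - move=> l l' /lU[t Ct tl] /lU[u Cu ul'].
      rewrite (hpsi t)// (hpsi u)//.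
      have [/RP[s e]|/RP[s e]] := totC _ _ Ct Cu.
        by rewrite e//; have [_ _] := svalP u; apply => // i /tl /s.
      by rewrite e//; have [_ _] := svalP t; apply => // i /ul' /s.
  exists (exist _ _ h) => s Cs; apply/RP; split => /=; first by move=> x; exists s.
  by move=> l sl; rewrite (hpsi s).
pose A1 : Type := {x | A x}; pose A2 : Type := {x | ~ A x}.
have [cv|[z cv]] : covers A1 [set: A2] \/ (exists x : A2, covers A2 [set: A1]).
  have [[z]|n] := pselect (inhabited A2); last by left; exists (fun=> None) => x; case: n.
  by have [|] := covers_total A1 A2; [left|right; exists z].
  (* The complement of [A] embeds into [A]. One-letter words stand for [A] and doubled letters for
     the complement, so [phi \o psi] embeds all of [L] into [A]. *)
  have [eta heta] := @covers_inj A1 A2 setT (exist _ _ Aa0) cv.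
  pose psi x := match pselect (A x) with
    | left _ => [:: x]
    | right nx => let y := sval (eta (exist _ x nx)) in [:: y; y] end.
  have psiA x : lists_in A (psi x).
    rewrite /psi; case: pselect => [Ax i /= [<-|]//|nx i /=].
    by case: (eta _) => y Ay /= [<-|[<-|]].
  have psi_inj x y : psi x = psi y -> x = y.
    rewrite /psi; case: pselect => Ax; case: pselect => Ay //=; first by case.
    by case=> /sval_inj /heta => /(_ I I) [].
  apply: (@squarable_of_inj _ a0 (fun l => phi (map (phi \o psi) l))) => l l'.
  have hl m : lists_in A (map (phi \o psi) m).
    by elim: m => //= x m IH i /= [<-|/IH//]; apply: (phiA _).
  move=> /(phi_inj _ _ (hl l) (hl l')).
  elim: l l' {hl} => [|x l IH] [|x' l'] //= [e /IH ->].
  by rewrite (psi_inj x x')//; apply: (phi_inj _ _ _ _ e).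
have [th hth] := @covers_inj A2 A1 setT z cv.
pose B : set L := [set x | exists2 y : A1, True & sval (th y) = x].
have BA x : B x -> ~ A x by case=> y _ <-; exact: (svalP (th y)).
(* [q] writes a letter as a tag followed by an element of [A]; the tag is [a0] on [A] and [a1] on
   the copy [B]. *)
have [q [q0 [qA qB]]] : exists q : L -> L * L,
    (forall x, A x -> q x = (a0, x)) /\ ((forall x, B x -> A (q x).2 /\ (q x).1 = a1) /\
    forall x y, B x -> B y -> (q x).2 = (q y).2 -> x = y).
  have [|q hq] := @choice _ _ (fun x (p : L * L) => (A x -> p = (a0, x)) /\
      (B x -> p.1 = a1 /\ exists y : A1, sval y = p.2 /\ sval (th y) = x)).
    move=> x; have [Ax|nAx] := pselect (A x).
      by exists (a0, x); split=> // /BA.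
    have [[y _ yx]|nB] := pselect (B x); last by exists (a0, a0).
    by exists (a1, sval y); split=> // _; split=> //; exists y.
  exists q; split; first by move=> x /(proj1 (hq x)).
  split=> [x Bx|x y Bx By e].
    by have [-> [y [<- _]]] := (proj2 (hq x)) Bx; split=> //; exact: (svalP y).
  have [_ [x' [e1 <-]]] := (proj2 (hq x)) Bx.
  have [_ [y' [e2 <-]]] := (proj2 (hq y)) By.
  by congr (sval (th _)); apply: sval_inj; rewrite /= e1 e2.
pose AB := A `|` B.
have q_inj x y : AB x -> AB y -> q x = q y -> x = y.
  move=> [Ax|Bx] [Ay|By] e.
  - by move: e; rewrite !q0// => -[].
  - by case: (a01 _); move: e; rewrite q0// => e; have [_ ] := qA _ By; rewrite -e.
  - by case: (a01 _); move: e; rewrite (q0 y)// => e; have [_ ] := qA _ Bx; rewrite e.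
  - by apply: qB => //; rewrite e.
have qAB x : AB x -> A (q x).1 /\ A (q x).2.
  by move=> [Ax|/qA[? ->]//]; rewrite q0.
pose code l := if pselect (A (phi (dbl q l))) is left Ax
  then sval (th (exist _ _ Ax)) else a0.
have codeB l : lists_in AB l -> B (code l).
  move=> hl; rewrite /code; case: pselect => [Ax|[]]; first by eexists.
  by apply: (phiA _); apply: (dbl_in qAB).
(* Words over [A] keep their codes in [A] and the new words are coded in [B], so the extension stays
   injective. *)
pose phi' l := if `[< lists_in A l >] then phi l else code l.
have h : ok (AB, phi').
  split=> /=; first by exists a0, a1; split; [left|left|].
    move=> l hl; rewrite /phi'; case: asboolP => [Al|_]; first by left; apply: (phiA _).
    by right; apply: codeB.
  move=> l l' hl hl'; rewrite /phi'; case: asboolP => Al; case: asboolP => Al'.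
  - by move=> e; apply: (phi_inj _ _ _ _ e).
  - by move=> e; case: (BA (code l')); [apply: codeB|rewrite -e; apply: (phiA _)].
  - by move=> e; case: (BA (code l)); [apply: codeB|rewrite e; apply: (phiA _)].
  - rewrite /code; case: pselect => [Ax|[]]; last by apply: (phiA _); apply: (dbl_in qAB).
    case: pselect => [Ax'|[]]; last by apply: (phiA _); apply: (dbl_in qAB).
    move=> /sval_inj/hth => /(_ I I) [] /phi_inj e.
    by apply: (dbl_inj q_inj) => //; apply: e; apply: (dbl_in qAB).
set tA := exist ok _ _ in maxA.
have /maxA/RP[/= sub _] : R tA (exist _ _ h).
  apply/RP; split=> /=; first by left.
  by move=> l hl; rewrite /phi' asboolT.
case: (svalP (th (exist _ _ Aa0))).
by apply: sub; right; exists (exist _ _ Aa0).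
Qed.

(** * The back-and-forth construction *)

(* Half of the data of a homeomorphism between closed sets; everything below is
   symmetric under exchanging [(P, f)] and [(K, g)]. *)
Definition half_iso (I : Type) (P K : set (I -> bool))
    (f g : (I -> bool) -> (I -> bool)) : Prop :=
  [/\ cclosed P, forall x, P x -> K (f x) /\ g (f x) = x
    & forall i, exists2 D, finite_set D &
        forall x y, P x -> P y -> agree D x y -> f x i = f y i].

(* An autohomeomorphism of the subproduct over [N] is represented by a pair of
   inverse self-maps of the whole cube that do not move the coordinates off [N]. *)
Definition half_ext (I : Type) (N : set I) (P : set (I -> bool))
    (f F G : (I -> bool) -> (I -> bool)) : Prop :=
  [/\ forall i, N i -> fsupp N (fun x => F x i),
      forall x i, ~ N i -> F x i = x i,
      forall x, G (F x) = x
    & forall x, P x -> agree N (F x) (f x)].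

Lemma half_ext_agree (I : Type) (N : set I) (P : set (I -> bool))
    (f F G : (I -> bool) -> (I -> bool)) x y :
  half_ext N P f F G -> agree N x y -> agree N (F x) (F y).
Proof.
move=> [h _ _ _] xy i Ni; have [D [_ DN hD]] := h _ Ni.
by apply: hD; apply: agree_sub xy.
Qed.

Lemma finite_bound (I : Type) (D : set I) (j : I -> nat) :
  finite_set D -> exists n, forall i, D i -> (j i <= n)%N.
Proof.
move=> /finite_setP_In[l Dl]; suff [n hn] : exists n,
    forall i, List.In i l -> (j i <= n)%N.
  by exists n => i /Dl/hn.
elim: l {Dl} => [|i l [n hn]]; first by exists 0.
exists (maxn n (j i)) => k /= [<-|/hn h]; first exact: leq_maxr.
by apply: (leq_trans h); exact: leq_maxl.
Qed.

Lemma fsupp_comp (I A B : Type) (V : set I) (h : (I -> bool) -> A) (k : A -> B) :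
  fsupp V h -> fsupp V (k \o h).
Proof. by move=> [D [fD DV hD]]; exists D; split => // x y /hD /= ->. Qed.

Lemma fsupp_coord (I : Type) (V : set I) i : V i -> fsupp V (fun x => x i).
Proof.
move=> Vi; exists [set i]; split; [exact: finite_set1|by move=> _ ->|].
by move=> x y; apply.
Qed.

Lemma fsupp_const (I A : Type) (V : set I) (a : A) : fsupp V (fun=> a).
Proof. by exists set0; split. Qed.

Lemma fsupp_bind (I A B : Type) (V : set I) (h : (I -> bool) -> A)
    (k : A -> (I -> bool) -> B) :
  fsupp V h -> (forall x, fsupp V (k (h x))) -> fsupp V (fun x => k (h x) x).
Proof.
move=> [D [fD DV hD]] hk; apply: fsupp_local => x.
have [E [fE EV hE]] := hk x; exists (D `|` E); split.
- by rewrite finite_setU.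
- by rewrite subUset.
- move=> y xy; rewrite -(hD x y); last by apply: agree_sub xy; left.
  by rewrite -(hE x y) //; apply: agree_sub xy; right.
Qed.

Lemma fsupp2 (I A B C : Type) (V : set I) (h : (I -> bool) -> A)
    (k : (I -> bool) -> B) (op : A -> B -> C) :
  fsupp V h -> fsupp V k -> fsupp V (fun x => op (h x) (k x)).
Proof.
move=> fh fk; apply: (@fsupp_bind _ _ _ _ h (fun a x => op a (k x))) => // x.
exact: (fsupp_comp (op (h x)) fk).
Qed.

Lemma fsupp_andb (I : Type) (V : set I) (h k : (I -> bool) -> bool) :
  fsupp V h -> fsupp V k -> fsupp V (fun x => h x && k x).
Proof. exact: fsupp2. Qed.

Lemma fsupp_negb (I : Type) (V : set I) (h : (I -> bool) -> bool) :
  fsupp V h -> fsupp V (fun x => ~~ h x).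
Proof. exact: fsupp_comp. Qed.

(* Countably many coordinates are added by a back-and-forth construction: [I0 u v]
   says that the clopen sets [u] and [v] may be matched. *)
Section BackAndForth.
Variables (I : Type) (P K : set (I -> bool)) (f g : (I -> bool) -> (I -> bool)).
Variables (N M : set I) (F G : (I -> bool) -> (I -> bool)).
Hypotheses (iF : half_ext N P f F G) (iG : half_ext N K g G F).
Hypothesis cM : covers nat M.
Variable I0 : ((I -> bool) -> bool) -> ((I -> bool) -> bool) -> Prop.
Hypothesis I0_fsupp : forall u v, I0 u v -> fsupp M u /\ fsupp M v.
Hypothesis I0_top : I0 (fun=> true) (fun=> true).
Hypothesis I0_bot : I0 (fun=> false) (fun=> false).
Hypothesis forth : forall u v x, I0 u v -> fsupp M x -> exists y, [/\ fsupp M y,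
  I0 (fun z => u z && x z) (fun z => v z && y z) &
  I0 (fun z => u z && ~~ x z) (fun z => v z && ~~ y z)].
Hypothesis back : forall u v y, I0 u v -> fsupp M y -> exists x, [/\ fsupp M x,
  I0 (fun z => u z && x z) (fun z => v z && y z) &
  I0 (fun z => u z && ~~ x z) (fun z => v z && ~~ y z)].
Hypothesis fibl : forall u v, I0 u v -> forall x, u x ->
  exists2 y, v y & agree N y (F x).
Hypothesis fibr : forall u v, I0 u v -> forall y, v y ->
  exists2 x, u x & agree N x (G y).
Hypothesis coml : forall u v, I0 u v -> forall z, P z -> u z -> v (f z).
Hypothesis comr : forall u v, I0 u v -> forall z, K z -> v z -> u (g z).

Let col := (I -> bool) -> seq bool.
(** A finite clopen partition is a colouring by bit words, and equally coloured cells are matched.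
    Words that do not occur name the empty cell, which [I0_bot] allows. *)
Let matched (p : col * col) := forall k,
  I0 (fun z => p.1 z == k) (fun z => p.2 z == k).

Let matched_fsupp p : matched p -> fsupp M p.1 /\ fsupp M p.2.
Proof.
move=> mp; split; apply: fsupp_local => x.
  have [[D [fD DM hD]] _] := I0_fsupp (mp (p.1 x)); exists D; split => // y /hD.
  by rewrite eqxx => /esym/eqP.
have [_ [D [fD DM hD]]] := I0_fsupp (mp (p.2 x)); exists D; split => // y /hD.
by rewrite eqxx => /esym/eqP.
Qed.

Let matched_cons p (x y : seq bool -> (I -> bool) -> bool) : matched p ->
  (forall k, I0 (fun z => (p.1 z == k) && x k z) (fun z => (p.2 z == k) && y k z)) ->
  (forall k, I0 (fun z => (p.1 z == k) && ~~ x k z)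
                (fun z => (p.2 z == k) && ~~ y k z)) ->
  matched (fun z => x (p.1 z) z :: p.1 z, fun z => y (p.2 z) z :: p.2 z).
Proof.
move=> mp h1 h2 [|b k] /=; first exact: I0_bot.
case: b.
  have := h1 k; congr I0; apply/funext => z; rewrite eqseq_cons andbC.
    by case: eqP => [->|]; rewrite ?andbF// eqb_id.
  by case: eqP => [->|]; rewrite ?andbF// eqb_id.
have := h2 k; congr I0; apply/funext => z; rewrite eqseq_cons andbC.
  by case: eqP => [->|]; rewrite ?andbF// eqbF_neg.
by case: eqP => [->|]; rewrite ?andbF// eqbF_neg.
Qed.

Let step p (x : (I -> bool) -> bool) : matched p -> fsupp M x -> exists q : col * col,
  matched (fun z => q.1 z, fun z => q.2 z) /\ exists a b,
   (forall z, q.1 z = a z :: x z :: p.1 z) /\ (forall z, q.2 z = x z :: b z :: p.2 z).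
Proof.
move=> mp fx.
have /choice[y hy] (k : seq bool) := forth (mp k) fx.
have mp' := @matched_cons p (fun=> x) y mp (fun k => let: And3 _ h _ := hy k in h)
   (fun k => let: And3 _ _ h := hy k in h).
have /choice[x' hx'] (k : seq bool) := back (mp' k) fx.
have mp'' := @matched_cons _ x' (fun=> x) mp'
   (fun k => let: And3 _ h _ := hx' k in h) (fun k => let: And3 _ _ h := hx' k in h).
eexists; split; first exact: mp''.
by do 2 eexists.
Qed.

Lemma back_and_forth : exists F' G',
  [/\ half_ext (N `|` M) P f F' G', half_ext (N `|` M) K g G' F',
      forall x, agree N (F' x) (F x) & forall x, agree N (G' x) (G x)].
Proof.
have [e he] := cM.
pose c n (z : I -> bool) := if e n is Some i then `[< M i >] && z i else false.
have fc n : fsupp M (c n).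
  rewrite /c; case: (e n) => [i|]; last exact: fsupp_const.
  by case: asboolP => [Mi|_]; [exact: (fsupp_coord Mi)|exact: fsupp_const].
pose T := {p | matched p}.
have /choice[nx hnx] (t : nat * T) : exists q : T, exists a b,
    (forall z, (sval q).1 z = a z :: c t.1 z :: (sval t.2).1 z) /\
    (forall z, (sval q).2 z = c t.1 z :: b z :: (sval t.2).2 z).
  have [q [mq [a [b [h1 h2]]]]] := step (svalP t.2) (fc t.1).
  by exists (exist _ _ mq), a, b.
have m0 : matched (fun=> [::], fun=> [::]).
  by case=> [|b k]; [exact: I0_top|exact: I0_bot].
pose X_ := fix s n : T := if n is m.+1 then nx (m, s m) else exist _ _ m0.
pose X n := (sval (X_ n)).1; pose Y n := (sval (X_ n)).2.
have XE n z : exists a, X n.+1 z = a :: c n z :: X n z.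
  by have [a [b [h _]]] := hnx (n, X_ n); exists (a z); rewrite /X /= h.
have YE n z : exists b, Y n.+1 z = c n z :: b :: Y n z.
  by have [a [b [_ h]]] := hnx (n, X_ n); exists (b z); rewrite /Y /= h.
have mXY n k : I0 (fun z => X n z == k) (fun z => Y n z == k) := svalP (X_ n) k.
have fX n : fsupp M (X n) by have [] := matched_fsupp (svalP (X_ n)).
have fY n : fsupp M (Y n) by have [] := matched_fsupp (svalP (X_ n)).
have XYle n m x y : (n <= m)%N -> X m x = Y m y -> X n x = Y n y.
  elim: m => [|m IH]; first by rewrite leqn0 => /eqP ->.
  rewrite leq_eqVlt => /orP[/eqP->//|/IH h e']; apply: h; move: e'.
  by have [a ->] := XE m x; have [b ->] := YE m y; case.
have /choice[j hj] (i : I) : exists n, M i -> e n = Some i.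
  by have [/he[n en]|nM] := pselect (M i); [exists n|exists 0].
have cj i z : M i -> c (j i) z = z i.
  by move=> Mi; rewrite /c hj// asboolT.
(* At each stage the enumerated coordinate stands at position 1 on the [X] side and at position 0 on
   the [Y] side; the other bit is its partner. Equality of the words of [x] and [F' x] therefore
   dictates these formulas. *)
pose F' x i := if `[< N i >] then F x i else
  if `[< M i >] then nth false (X (j i).+1 x) 0 else x i.
pose G' y i := if `[< N i >] then G y i else
  if `[< M i >] then nth false (Y (j i).+1 y) 1 else y i.
have F'N x : agree N (F' x) (F x) by move=> i Ni; rewrite /F' asboolT.
have G'N y : agree N (G' y) (G y) by move=> i Ni; rewrite /G' asboolT.
have YF' n x : Y n (F' x) = X n x.
  have [D [fD DM hD]] := fY n; have [k hk] := finite_bound j fD.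
  (* This stage is late enough to contain the word of stage [n] and to have asked for every
     coordinate of [D], so [y] and [F' x] agree on [D]. *)
  have [y /eqP Yy yF] := fibl (mXY (maxn n k.+1) (X (maxn n k.+1) x)) (eqxx _).
  rewrite (XYle n _ x y (leq_maxl n k.+1))//; apply: hD => i Di.
  have Mi := DM _ Di; rewrite /F'; case: asboolP => [/yF//|_].
  rewrite asboolT// (XYle _ (maxn n k.+1) x y) //; last first.
    by apply: leq_trans (leq_maxr _ _); rewrite ltnS hk.
  by have [b ->] := YE (j i) y; rewrite /= cj.
have XG' n y : X n (G' y) = Y n y.
  have [D [fD DM hD]] := fX n; have [k hk] := finite_bound j fD.
  have [x /eqP Xx xG] := fibr (mXY (maxn n k.+1) (Y (maxn n k.+1) y)) (eqxx _).
  rewrite -(XYle n _ x y (leq_maxl n k.+1))//; apply: hD => i Di.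
  have Mi := DM _ Di; rewrite /G'; case: asboolP => [/xG//|_].
  rewrite asboolT// -(XYle _ (maxn n k.+1) x y) //; last first.
    by apply: leq_trans (leq_maxr _ _); rewrite ltnS hk.
  by have [b ->] := XE (j i) x; rewrite /= cj.
have GF' x : G' (F' x) = x.
  apply/funext => i; rewrite /G'; case: asboolP => [Ni|nN].
    have [_ _ GF _] := iF; rewrite -[in RHS](GF x).
    exact: (half_ext_agree iG (F'N x)).
  case: asboolP => [Mi|nM]; last by rewrite /F' !asboolF.
  by rewrite YF'; have [a ->] := XE (j i) x; rewrite /= cj.
have FG' y : F' (G' y) = y.
  apply/funext => i; rewrite /F'; case: asboolP => [Ni|nN].
    have [_ _ FG _] := iG; rewrite -[in RHS](FG y).
    exact: (half_ext_agree iF (G'N y)).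
  case: asboolP => [Mi|nM]; last by rewrite /G' !asboolF.
  by rewrite XG'; have [a ->] := YE (j i) y; rewrite /= cj.
exists F', G'; split=> //; split=> //.
- move=> i NMi; rewrite /F'; case: asboolP => [Ni|nN].
    by apply: (@fsuppW _ _ N) => [k ?|]; [left|have [+ _ _ _] := iF; apply].
  case: asboolP => [Mi|nM]; last by case: NMi.
  apply: (@fsuppW _ _ M); first by move=> k; right.
  exact: (fsupp_comp (fun s => nth false s 0) (fX _)).
- by move=> x i /not_orP[Ni Mi]; rewrite /F' !asboolF.
- move=> z Pz i NMi; rewrite /F'; case: asboolP => [Ni|nN].
    by have [_ _ _] := iF; apply.
  case: asboolP => [Mi|nM]; last by case: NMi.
  have /eqP := coml (mXY (j i).+1 (X (j i).+1 z)) Pz (eqxx _).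
  by have [b ->] := YE (j i) (f z) => <-; rewrite /= cj.
- move=> i NMi; rewrite /G'; case: asboolP => [Ni|nN].
    by apply: (@fsuppW _ _ N) => [k ?|]; [left|have [+ _ _ _] := iG; apply].
  case: asboolP => [Mi|nM]; last by case: NMi.
  apply: (@fsuppW _ _ M); first by move=> k; right.
  exact: (fsupp_comp (fun s => nth false s 1) (fY _)).
- by move=> x i /not_orP[Ni Mi]; rewrite /G' !asboolF.
- move=> z Kz i NMi; rewrite /G'; case: asboolP => [Ni|nN].
    by have [_ _ _] := iG; apply.
  case: asboolP => [Mi|nM]; last by case: NMi.
  have /eqP := comr (mXY (j i).+1 (Y (j i).+1 z)) Kz (eqxx _).
  by have [b ->] := XE (j i) (g z) => <-; rewrite /= cj.
Qed.

End BackAndForth.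

(** * The first step: the Knaster-Reichbach theorem *)

(** Then [f] on [P] induces a continuous map between the projections to $D^M$. *)
Definition coord_closed (I : Type) (M : set I) (P : set (I -> bool))
    (f : (I -> bool) -> (I -> bool)) : Prop :=
  forall i, M i -> exists D, [/\ finite_set D, D `<=` M &
    forall x y, P x -> P y -> agree D x y -> f x i = f y i].

(* [x o f] is defined on [P] only; it extends to a finitely supported function. *)
Lemma pullback (I : Type) (M : set I) (P : set (I -> bool))
    (f : (I -> bool) -> (I -> bool)) (A : Type) (x : (I -> bool) -> A) :
  coord_closed M P f -> fsupp M x ->
  exists2 y, fsupp M y & forall z, P z -> y z = x (f z).
Proof.
move=> cM [D [fD DM hD]].
have /choice[E hE] (i : I) : exists E, M i -> [/\ finite_set E, E `<=` M &
    forall x y, P x -> P y -> agree E x y -> f x i = f y i].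
  by have [/cM[E hE]|nM] := pselect (M i); [exists E|exists set0].
pose U := \bigcup_(i in D) E i.
have fU : finite_set U by apply: bigcup_finite => // i /DM /hE [].
have UM : U `<=` M by move=> k [i /DM /hE [_ EM _] /EM].
have hU z z' : P z -> P z' -> agree U z z' -> x (f z) = x (f z').
  move=> Pz Pz' zz'; apply: hD => i Di; have [_ _ h] := hE _ (DM _ Di).
  by apply: h => // k Ek; apply: zz'; exists i.
pose r z z' := P z' /\ agree U z z'.
exists (fun z => x (f (xget (fun=> true) (r z)))).
  exists U; split=> // z z' zz'; rewrite (_ : r z = r z')//.
  apply/seteqP; split=> w [Pw zw]; split=> //; apply: agree_trans zw => //.
  exact: agree_sym.
move=> z Pz; case: xgetP => [w -> [Pw zw]|/(_ z)[]//].
by apply: hU => //; exact: agree_sym.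
Qed.

Lemma infinite_countable_subset (I : Type) (A : set I) : infinite_set A ->
  exists B, [/\ B `<=` A, covers nat B & infinite_set B].
Proof.
move=> iA; have [a0 _] := infinite_setN0 iA.
have /infiniteP/card_leP[h] := iA.
pose nu n : I := val (h (to_setT n)).
have nu_inj m n : nu m = nu n -> m = n.
  by move=> /val_inj e; have := @inj _ _ _ h _ _ (in_setT _) (in_setT _) e; case.
exists (range nu); split.
- by move=> _ [n _ <-]; exact: set_valP.
- by apply: covers_image; exists Some => n _; exists n.
- move=> fB; apply: infinite_nat.
  rewrite (_ : [set: nat] = nu @^-1` range nu).
    by apply: finite_preimage => // m n _ _; exact: nu_inj.
  by apply/seteqP; split=> n _ //; exists n.
Qed.

Definition inner (I : Type) (P : set (I -> bool)) (x : I -> bool) : Prop :=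
  exists2 D, finite_set D & forall y, agree D x y -> P y.

(* If a finite condition on [M] does not force membership in [P], then it has a
   finite extension within [M] that excludes [P]. *)
Definition escape (I : Type) (M : set I) (P : set (I -> bool)) : Prop :=
  forall D x, finite_set D -> D `<=` M -> (exists2 b, agree D x b & ~ P b) ->
    exists b D', [/\ finite_set D', D' `<=` M, agree D x b &
      forall z, agree D' b z -> ~ P z].

(** The last clause records whether there is room outside [P] and [K]. For a homeomorphism [f], the
    last two clauses together make [u] empty exactly when [v] is. *)
Definition kr_match (I : Type) (M : set I) (P K : set (I -> bool))
    (f : (I -> bool) -> (I -> bool)) (u v : (I -> bool) -> bool) : Prop :=
  [/\ fsupp M u, fsupp M v, forall z, P z -> u z = v (f z) &
      (forall z, u z -> P z) <-> (forall z, v z -> K z)].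

Lemma exists_fresh (I : Type) (M D : set I) :
  infinite_set M -> finite_set D -> exists2 c, M c & ~ D c.
Proof.
move=> iM fD; have [c [Mc nDc]] := infinite_setN0 (infinite_setD iM fD).
by exists c.
Qed.

Definition upd (I : Type) (c : I) (b : bool) (x : I -> bool) : I -> bool :=
  mix [set c] (fun=> b) x.

Lemma upd_eq (I : Type) (c : I) (b : bool) (x : I -> bool) : upd c b x c = b.
Proof. by rewrite /upd /mix asboolT. Qed.

Lemma upd_agree (I : Type) (c : I) (b : bool) (D : set I) (x : I -> bool) :
  ~ D c -> agree D x (upd c b x).
Proof.
move=> nDc; apply: agree_sym; apply: mix_out => i Di e.
by apply: nDc; rewrite -e.
Qed.

Section KnasterReichbach.
Variables (I : Type) (M : set I) (P K : set (I -> bool)) (f g : (I -> bool) -> (I -> bool)).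
Hypotheses (isoPK : half_iso P K f g) (isoKP : half_iso K P g f).
Hypotheses (cMg : coord_closed M K g) (eP : escape M P) (eK : escape M K).
Hypothesis iM : infinite_set M.
Hypothesis innerPK : forall x, P x -> inner P x -> inner K (f x).

Let fP x : P x -> K (f x). Proof. by have [_ h _] := isoPK; move/h => []. Qed.
Let gK x : K x -> P (g x). Proof. by have [_ h _] := isoKP; move/h => []. Qed.
Let fgK x : K x -> f (g x) = x. Proof. by have [_ h _] := isoKP; move/h => []. Qed.
Let gfK x : P x -> g (f x) = x. Proof. by have [_ h _] := isoPK; move/h => []. Qed.

(** Here [y] is forced to be the image of [u && x] under [f]. That image is closed like [K], and
    open because all its points are images of inner points. *)
Lemma kr_forth_in u v (x : (I -> bool) -> bool) : kr_match M P K f u v -> fsupp M x ->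
  (forall z, u z -> x z -> P z) -> exists y, [/\ fsupp M y,
  kr_match M P K f (fun z => u z && x z) (fun z => v z && y z) &
  kr_match M P K f (fun z => u z && ~~ x z) (fun z => v z && ~~ y z)].
Proof.
move=> [fu fv uv uvP] fx xP; have [y0 fy0 hy0] := pullback cMg fx.
pose y w := v w && y0 w && `[< K w >].
have fvy0 : fsupp M (fun w => v w && y0 w) by exact: fsupp2.
have yK w : K w -> v w -> y0 w -> exists D, [/\ finite_set D, D `<=` M &
    forall w', agree D w w' -> K w'].
  move=> Kw vw yw; have [D fD hD] : inner K w.
    rewrite -(fgK Kw); apply: innerPK; first exact: gK.
    have [D [fD _ hD]] : fsupp M (fun z => u z && x z) by exact: fsupp2.
    exists D => // z /hD; rewrite uv ?fgK ?vw -?hy0 ?yw//=; last exact: gK.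
    by move=> /esym/andP[uz xz]; exact: xP.
  (* [D] may leave [M], but its part in [M] suffices: otherwise [escape] yields a condition on [M]
     that excludes [K] and is compatible with [D]. *)
  exists (D `&` M); split; [exact: finite_setI2|by move=> i []|].
  move=> w' ww'; apply: contrapT => nK.
  have [b [D' [fD' D'M wb hb]]] : exists b D', [/\ finite_set D', D' `<=` M,
      agree (D `&` M) w b & forall z, agree D' b z -> ~ K z].
    apply: eK; [exact: finite_setI2|by move=> i []|].
    by exists w'.
  apply: (hb (mix M b w)).
    by apply: agree_sym; apply: (agree_sub D'M); exact: mix_in.
  apply: hD; apply: agree_sym; apply: agree_mix => //.
  exact: agree_sym.
have fy : fsupp M y.
  apply: fsupp_local => w.
  have [D [fD DM hD]] := fvy0.
  have [hw|hw] := boolP (v w && y0 w); last first.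
    by exists D; split=> // w' ww'; rewrite /y -!(hD w w')// (negbTE hw).
  have [vw yw] := andP hw.
  have [Kw|nKw] := pselect (K w).
    have [D1 [fD1 D1M hD1]] := yK _ Kw vw yw.
    exists (D `|` D1); split; first by rewrite finite_setU.
      by rewrite subUset.
    move=> w' ww'; rewrite /y -!(hD w w')// ?asboolT//.
      by apply: hD1; apply: agree_sub ww'; right.
    by apply: agree_sub ww'; left.
  have [||D1 [fD1 D1M hD1]] := @separation _ M K w.
  - by have [] := isoKP.
  - move=> z Kz wz; apply: nKw.
    have : v z && y0 z by rewrite -(hD w z)//; apply: agree_sub wz.
    move=> /andP[vz yz]; have [E [_ EM hE]] := yK _ Kz vz yz.
    by apply: hE; apply: agree_sym; apply: agree_sub wz.
  exists (D `|` D1); split; first by rewrite finite_setU.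
    by rewrite subUset.
  move=> w' ww'; rewrite /y -!(hD w w')// ?asboolF//.
    by apply: hD1; apply: agree_sub ww'; right.
  by apply: agree_sub ww'; left.
have yE z : P z -> v (f z) -> y (f z) = x z.
  move=> Pz vz; rewrite /y vz asboolT ?andbT/= ?hy0 ?gfK//; exact: fP.
have yK' z : y z -> K z by move=> /andP[_ /asboolP].
have nx := fsupp_negb fx; have ny := fsupp_negb fy.
exists y; split=> //; split; do ?by apply: fsupp_andb.
- move=> z Pz; rewrite uv//; case vz : (v (f z)) => //=.
  by rewrite yE.
- split=> _ z /andP[]; first by move=> _ /yK'.
  exact: xP.
- move=> z Pz; rewrite uv//; case vz : (v (f z)) => //=.
  by rewrite yE.
- split=> [uxP z /andP[vz _]|vyK z /andP[uz _]].
    apply: (proj1 uvP) vz => w uw; have [xw|xw] := boolP (x w); first exact: xP.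
    by apply: uxP; rewrite uw.
  apply: (proj2 uvP) uz => w vw; have [/yK'//|yw] := boolP (y w).
  by apply: vyK; rewrite vw.
Qed.

(** If one half of [u] lies in [P], the previous lemma applies to that half. Otherwise both halves
    of [v] have to leave [K], which is achieved by splitting a box of [v] that misses [K]. *)
Lemma kr_forth u v (x : (I -> bool) -> bool) :
  kr_match M P K f u v -> fsupp M x -> exists y, [/\ fsupp M y,
  kr_match M P K f (fun z => u z && x z) (fun z => v z && y z) &
  kr_match M P K f (fun z => u z && ~~ x z) (fun z => v z && ~~ y z)].
Proof.
move=> uvm fx; have [h|/existsNP[p hp]] :=
  pselect (forall z, u z -> x z -> P z); first exact: kr_forth_in.
have [h|/existsNP[q hq]] := pselect (forall z, u z -> ~~ x z -> P z).
  have [y [fy h1 h2]] := kr_forth_in uvm (fsupp_negb fx) h.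
  exists (fun z => ~~ y z); split; [exact: fsupp_negb|move: h2|].
    by congr (kr_match _ _ _ _ _ _); apply/funext => ?; rewrite negbK.
  by move: h1; congr (kr_match _ _ _ _ _ _); apply/funext => ?; rewrite negbK.
have [fu fv uv uvP] := uvm; have [y0 fy0 hy0] := pullback cMg fx.
have [w vw nKw] : exists2 w, v w & ~ K w.
  apply: contrapT => n; apply: hp => up _; apply: (proj2 uvP) up => z vz.
  by apply: contrapT => nKz; apply: n; exists z.
have [D [fD DM hD]] := fv.
have [|b [D' [fD' D'M wb hb]]] := eK fD DM (x := w); first by exists w.
pose E := D `|` D'.
have fE : finite_set E by rewrite finite_setU.
(* The box given by [E] and [b] misses [K], so cutting it along a free coordinate [c] does not
   interfere with [f]. *)
have [c Mc nEc] := exists_fresh iM fE.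
have EM : E `<=` M by rewrite subUset.
have inK z : agree E b z -> v z /\ ~ K z.
  move=> bz; split; last by apply: hb; apply: agree_sub bz; right.
  by rewrite -(hD w z)//; apply: (agree_trans wb); apply: agree_sub bz; left.
pose y z := if `[< agree E b z >] then z c else y0 z.
have fy : fsupp M y.
  apply: (@fsupp_bind _ _ _ _ (fun z => `[< agree E b z >])
     (fun t z => if t then z c else y0 z)).
    exists E; split; [exact: fE|exact: EM|move=> z z' zz'].
    congr (`[< _ >]); apply/propext.
    by split=> h; apply: (agree_trans h) => //; exact: agree_sym.
  by move=> z; case: asboolP => _ //; exact: fsupp_coord.
have yE z : P z -> y (f z) = x z.
  move=> Pz; rewrite /y asboolF ?hy0 ?gfK//; first exact: fP.
  by move=> /inK[_]; apply; exact: fP.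
have hc t : v (upd c t b) /\ ~ K (upd c t b) /\ y (upd c t b) = t.
  have h : agree E b (upd c t b) by exact: upd_agree.
  by have [? ?] := inK _ h; do ![split=> //]; rewrite /y asboolT// upd_eq.
have nx := fsupp_negb fx; have ny := fsupp_negb fy.
exists y; split=> //; split; do ?by apply: fsupp_andb.
- by move=> z Pz; rewrite uv// yE.
- split=> h; first by case: hp => up xp; apply: h; rewrite up.
  have [h1 [h2 h3]] := hc true; case: h2; apply: h; by rewrite h1 h3.
- by move=> z Pz; rewrite uv// yE.
- split=> h; first by case: hq => uq xq; apply: h; rewrite uq.
  have [h1 [h2 h3]] := hc false; case: h2; apply: h; by rewrite h1 h3.
Qed.

End KnasterReichbach.

Lemma kr_match_sym (I : Type) (M : set I) (P K : set (I -> bool)) f g u v :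
  half_iso P K f g -> half_iso K P g f ->
  kr_match M P K f u v -> kr_match M K P g v u.
Proof.
move=> [_ fP _] [_ gK _] [fu fv uv [h1 h2]]; split=> // z Kz.
by have [Pg fg] := gK _ Kz; rewrite uv// fg.
Qed.

Definition supp_in (I : Type) (P : set (I -> bool))
    (f : (I -> bool) -> (I -> bool)) (D E : set I) : Prop :=
  forall i, D i -> exists D', [/\ finite_set D', D' `<=` E &
    forall x y, P x -> P y -> agree D' x y -> f x i = f y i].

Lemma supp_in_exists (I : Type) (P : set (I -> bool))
    (f : (I -> bool) -> (I -> bool)) (D : set I) : finite_set D ->
  (forall i, D i -> exists2 D', finite_set D' &
    forall x y, P x -> P y -> agree D' x y -> f x i = f y i) ->
  exists2 E, finite_set E & supp_in P f D E.
Proof.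
move=> fD hf; have /choice[E hE] (i : I) : exists E, D i -> finite_set E /\
    forall x y, P x -> P y -> agree E x y -> f x i = f y i.
  have [/hf[E fE hE]|nD] := pselect (D i); last by exists set0.
  by exists E.
exists (\bigcup_(i in D) E i); first by apply: bigcup_finite => // i /hE[].
move=> i Di; have [fE h] := hE _ Di; exists (E i); split=> // k Ek.
by exists i.
Qed.

Lemma supp_in_sub (I : Type) (P : set (I -> bool))
    (f : (I -> bool) -> (I -> bool)) (D E E' : set I) : E `<=` E' ->
  supp_in P f D E -> supp_in P f D E'.
Proof.
move=> EE h i /h[D' [fD D'E hD]]; exists D'; split=> //.
exact: subset_trans EE.
Qed.

Lemma coord_closedP (I : Type) (M : set I) (P : set (I -> bool))
    (f : (I -> bool) -> (I -> bool)) :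
  (forall D, finite_set D -> D `<=` M -> exists2 E, E `<=` M & supp_in P f D E) ->
  coord_closed M P f.
Proof.
move=> h i Mi.
have [|_ ->//|E EM /(_ i erefl)[D [fD DE hD]]] := h [set i].
  exact: finite_set1.
by exists D; split => //; apply: subset_trans EM.
Qed.

Lemma half_iso_supp_in (I : Type) (P K : set (I -> bool)) f g (D : set I) :
  half_iso P K f g -> finite_set D -> exists2 E, finite_set E & supp_in P f D E.
Proof. by move=> [_ _ h] fD; apply: supp_in_exists. Qed.

Lemma first_step (I : Type) (P K : set (I -> bool)) f g (M0 : set I) :
  half_iso P K f g -> half_iso K P g f ->
  (exists x, ~ P x) -> (exists x, ~ K x) ->
  (forall x, P x -> inner P x -> inner K (f x)) ->
  (forall x, K x -> inner K x -> inner P (g x)) ->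
  infinite_set [set: I] -> covers nat M0 ->
  exists M F G, [/\ M0 `<=` M, covers nat M, half_ext M P f F G
                  & half_ext M K g G F].
Proof.
move=> isoPK isoKP [xP nxP] [xK nxK] inPK inKP iI cM0.
pose Q (b : bool) (D : set I) (y : I -> bool) E :=
  supp_in (if b then P else K) (if b then f else g) D E /\
  ((exists2 z, agree D y z & ~ (if b then P else K) z) -> exists z D',
   [/\ finite_set D', D' `<=` E, agree D y z & forall w, agree D' z w ->
       ~ (if b then P else K) w]).
(* [B] makes [M] infinite, which provides the fresh coordinates. *)
have [B [_ cB iB]] := infinite_countable_subset iI.
have [|||M [M0M cM hM]] := @closing_off nat I bool (M0 `|` B) Q squarable_nat.
- by apply: covers_finite; [exact: squarable_nat|exact: finite_finset].
- by apply: coversU => //; exact: squarable_nat.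
- move=> b D x fD.
  have [E1 fE1 hE1] : exists2 E, finite_set E & 
      supp_in (if b then P else K) (if b then f else g) D E.
    by case: (b); [apply: half_iso_supp_in isoPK _|apply: half_iso_supp_in isoKP _].
  have [E2 fE2 hE2] : exists2 E, finite_set E & forall y, agree D x y ->
      ((exists2 z, agree D y z & ~ (if b then P else K) z) -> exists z D',
   [/\ finite_set D', D' `<=` E, agree D y z & forall w, agree D' z w ->
       ~ (if b then P else K) w]).
    have [[z xz nz]|n] := pselect (exists2 z, agree D x z & ~ (if b then P else K) z);
      last first.
      exists set0 => // y xy [z yz nz]; case: n; exists z => //.
      exact: agree_trans yz.
    have [D' fD' hD'] : exists2 D', finite_set D' & forall w, agree D' z w ->
        ~ (if b then P else K) w.
      by case: (b) nz; [have [cl _ _] := isoPK|have [cl _ _] := isoKP]; apply: cl.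
    exists D' => // y xy _; exists z, D'; split=> //.
    by apply: agree_trans xz; exact: agree_sym.
  exists (E1 `|` E2).
    apply: covers_finite; first exact: squarable_nat.
    by rewrite finite_setU.
  move=> y xy; split; first by apply: supp_in_sub hE1 => i; left.
  move=> /(hE2 _ xy)[z [D' [fD' D'E yz hz]]]; exists z, D'; split=> //.
  by move=> i /D'E; right.
have iM : infinite_set M.
  by apply: sub_infinite_set iB => i Bi; apply: M0M; right.
have cMf : coord_closed M P f.
  apply: coord_closedP => D fD DM; have [E EM [h _]] := hM true D xP fD DM.
  by exists E.
have cMg : coord_closed M K g.
  apply: coord_closedP => D fD DM; have [E EM [h _]] := hM false D xP fD DM.
  by exists E.
have eP : escape M P.
  move=> D x fD DM h; have [E EM [_ /(_ h)[z [D' [? D'E ? ?]]]]] := hM true D x fD DM.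
  by exists z, D'; split=> //; apply: subset_trans EM.
have eK : escape M K.
  move=> D x fD DM h; have [E EM [_ /(_ h)[z [D' [? D'E ? ?]]]]] := hM false D x fD DM.
  by exists z, D'; split=> //; apply: subset_trans EM.
have [_ fP _] := isoPK; have [_ gK _] := isoKP.
(* Over the empty set of coordinates the identity is an extension, and the fiber conditions only ask
   that matched sets be empty together. *)
have e0 (J : Type) (Z : set (J -> bool)) h : half_ext set0 Z h id id.
  by split=> [i []|//|//|x _ i []].
have [|||u v x h fx|u v y h fy|u v h x ux|u v h y vy|u v h z Pz uz|u v h z Kz vz|
    F [G [h1 h2 _ _]]] := @back_and_forth I P K f g set0 M id id (e0 _ _ _) (e0 _ _ _)
    cM (kr_match M P K f).
- by move=> u v [].
- split=> //; try exact: fsupp_const.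
  by split=> h; [case: nxP; apply: h|case: nxK; apply: h].
- by split=> //; exact: fsupp_const.
- exact: (kr_forth isoPK isoKP cMg eK iM inPK h fx).
- have h' := kr_match_sym isoPK isoKP h.
  have [x [fx m1 m2]] := kr_forth isoKP isoPK cMf eP iM inKP h' fy.
  by exists x; split=> //; exact: (kr_match_sym isoKP isoPK).
- have [_ _ uv [uP _]] := h; have [Px|nPx] := pselect (P x).
    by exists (f x) => //; rewrite -uv.
  apply: contrapT => n; apply: nPx; apply: (proj2 (let: And4 _ _ _ e := h in e)) ux.
  by move=> z vz; case: n; exists z.
- have [_ _ uv _] := h; have [Ky|nKy] := pselect (K y).
    by have [Pg fg] := gK _ Ky; exists (g y) => //; rewrite uv// fg.
  apply: contrapT => n; apply: nKy; apply: (proj1 (let: And4 _ _ _ e := h in e)) vy.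
  by move=> z uz; case: n; exists z.
- by have [_ _ uv _] := h; rewrite -uv.
- by have [_ _ uv _] := h; have [Pg fg] := gK _ Kz; rewrite uv// fg.
exists M, F, G; split; rewrite ?set0U// in h1 h2 *.
by move=> i M0i; apply: M0M; left.
Qed.

(** * Adding countably many coordinates *)

Definition tube (I : Type) (N : set I) (P : set (I -> bool)) (w : I -> bool) : Prop :=
  forall y, agree N w y -> P y.

(** By the first clause, over a point of $D^N$ that gives no tube, no finite condition forces
    membership in [P]: the fiber of [P] has empty interior. The second clause makes [f] respect the
    exceptional points. *)
Definition half_good (I : Type) (N : set I) (P K : set (I -> bool))
    (f : (I -> bool) -> (I -> bool)) : Prop :=
  (forall a D, finite_set D -> tube (N `|` D) P a -> tube N P a) /\
  (forall w, tube N P w -> tube N K (f w)).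

(** The projection of [u] to $D^N$, as an $N$-saturated subset of the cube. *)
Definition shadow (I : Type) (N : set I) (u : (I -> bool) -> bool) (z : I -> bool) :=
  `[< exists2 z', u z' & agree N z' z >].

Definition over_tube (I : Type) (M N : set I) (P : set (I -> bool)) (w : I -> bool) :=
  exists2 p, agree (M `&` N) w p & tube N P p.

(* The fibers of [P] over the points of [D^(M n N)] that do not come from a tube
   are nowhere dense in the coordinates of [M \ N]. *)
Definition fiber_escape (I : Type) (M N : set I) (P : set (I -> bool)) : Prop :=
  forall w D, finite_set D -> D `<=` M -> ~ over_tube M N P w ->
    exists b D', [/\ finite_set D', D' `<=` M, agree D w b, agree (D' `&` N) w b &
      forall z, agree D' b z -> ~ P z].

(** The last two clauses say that [F] carries the projection of [u] to $D^N$ onto that of [v]. They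
    replace the inclusion clause of [kr_match]. *)
Definition fiber_match (I : Type) (M N : set I) (P : set (I -> bool))
    (f F G : (I -> bool) -> (I -> bool)) (u v : (I -> bool) -> bool) : Prop :=
  [/\ fsupp M u, fsupp M v, forall z, P z -> u z = v (f z),
      forall x, u x -> exists2 y, v y & agree N y (F x) &
      forall y, v y -> exists2 x, u x & agree N x (G y)].

Lemma tube_agree (I : Type) (N : set I) (P : set (I -> bool)) x y :
  agree N x y -> tube N P x -> tube N P y.
Proof. by move=> xy h z yz; apply: h; apply: agree_trans yz. Qed.

Lemma cclosed_tube (I : Type) (N : set I) (P : set (I -> bool)) :
  cclosed P -> cclosed (tube N P).
Proof.
move=> cP x /existsNP[y /not_implyP[xy nPy]].
have [D fD hD] := cP _ nPy; exists (D `&` N); first exact: finite_setI2.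
move=> z xz tz; apply: (hD (mix N z y)); last by apply: tz; apply: agree_sym; exact: mix_in.
apply: agree_sym; apply: agree_mix => // i [Di Ni].
by rewrite -xz // xy.
Qed.

Lemma fsupp_shadow (I : Type) (M N : set I) (u : (I -> bool) -> bool) :
  fsupp M u -> fsupp (M `&` N) (shadow N u).
Proof.
move=> [D [fD DM hD]]; exists (D `&` N); split; first exact: finite_setI2.
  by apply: setSI.
suff h z z' : agree (D `&` N) z z' -> shadow N u z -> shadow N u z'.
  move=> z z' zz'; apply/idP/idP; first exact: h.
  by apply: h; exact: agree_sym.
move=> zz' /asboolP[w uw wz]; apply/asboolP; exists (mix N z' w); last exact: mix_in.
rewrite -(hD w)//; apply: agree_sym; apply: agree_mix => // i [Di Ni].
by rewrite -zz' // wz.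
Qed.

Lemma fsupp_agree (I A : Type) (M N : set I) (h : (I -> bool) -> A) x y :
  fsupp (M `&` N) h -> agree N x y -> h x = h y.
Proof.
by move=> [D [_ DMN hD]] xy; apply: hD => i /DMN[_ Ni]; exact: xy.
Qed.

Section FiberedStep.
Variables (I : Type) (M N : set I) (P K : set (I -> bool)).
Variables (f g F G : (I -> bool) -> (I -> bool)).
Hypotheses (isoPK : half_iso P K f g) (isoKP : half_iso K P g f).
Hypotheses (iF : half_ext N P f F G) (iG : half_ext N K g G F).
Hypotheses (cMg : coord_closed M K g) (cG : coord_closed (M `&` N) setT G).
Hypotheses (gKP : half_good N K P g) (eK : fiber_escape M N K).
Hypothesis iMN : infinite_set (M `\` N).

(** The pullback [y0] is right on [K] but may have wrong projections to $D^N$. It is corrected off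
    [K] only, which is possible because the fibers to be corrected are nowhere dense. *)
Lemma fiber_forth u v (x : (I -> bool) -> bool) :
  fiber_match M N P f F G u v -> fsupp M x -> exists y, [/\ fsupp M y,
  fiber_match M N P f F G (fun z => u z && x z) (fun z => v z && y z) &
  fiber_match M N P f F G (fun z => u z && ~~ x z) (fun z => v z && ~~ y z)].
Proof.
move=> [fu fv uv fibl fibr] fx.
have [_ fP _] := isoPK; have [_ gK _] := isoKP.
have [_ _ GF _] := iF; have [_ _ FG Gg] := iG.
have [y0 fy0 hy0] := pullback cMg fx.
have MNM : M `&` N `<=` M by move=> i [].
have fnx := fsupp_negb fx; have fny0 := fsupp_negb fy0.
have fG (A : Type) (h : (I -> bool) -> A) :
    fsupp (M `&` N) h -> fsupp (M `&` N) (fun w => h (G w)).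
  move=> fh; have [h' fh' e] := pullback cG fh.
  by rewrite (_ : (fun w => h (G w)) = h')//; apply/funext => w; rewrite e.
(* [X1] and [X2] tell where the two halves of [v] are due to have points, [O1] and [O2] where the
   halves cut by [y0] have some. On [W] both are due and [y0] misses at least one. *)
pose X1 w := shadow N (fun z => u z && x z) (G w).
pose X2 w := shadow N (fun z => u z && ~~ x z) (G w).
have fX1 : fsupp (M `&` N) X1 by apply: fG; apply: fsupp_shadow; exact: fsupp_andb.
have fX2 : fsupp (M `&` N) X2 by apply: fG; apply: fsupp_shadow; exact: fsupp_andb.
pose O1 := shadow N (fun w => v w && y0 w).
pose O2 := shadow N (fun w => v w && ~~ y0 w).
have fO1 : fsupp (M `&` N) O1 by apply: fsupp_shadow; exact: fsupp_andb.
have fO2 : fsupp (M `&` N) O2 by apply: fsupp_shadow; exact: fsupp_andb.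
pose W w := (X1 w && X2 w) && ~~ (O1 w && O2 w).
have fW : fsupp (M `&` N) W.
  by apply: fsupp_andb; [|apply: fsupp_negb]; apply: fsupp_andb.
have tubeG w : over_tube M N K w -> exists2 p, agree (M `&` N) w (F p) &
    tube N P p /\ agree (M `&` N) (G w) p.
  move=> [p wp tp]; have Kp : K p by apply: tp.
  exists (G p); first by rewrite FG.
  split; first by apply: tube_agree (proj2 gKP _ tp); apply: agree_sym; exact: Gg.
  move=> i MNi; have [D [_ DMN hD]] := cG MNi.
  by apply: hD => //; exact: agree_sub wp.
(* Over a tube the relevant fiber of [P] is everything, so [f] transfers all points of [u] there and
   [y0] cuts [v] as [x] cuts [u]. *)
have notW w : W w -> ~ over_tube M N K w.
  move=> /andP[/andP[/asboolP[z1 /andP[uz1 xz1] z1w] /asboolP[z2 /andP[uz2 xz2] z2w]]].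
  move=> /negP nO tw; apply: nO.
  have [p wp [tp Gp]] := tubeG _ tw.
  have key (z : I -> bool) : agree N z (G w) -> u z -> exists2 w', v w' &
      agree N w' w /\ y0 w' = x z.
    move=> zw uz; pose z' := mix N p z.
    have Pz' : P z' by apply: tp; apply: agree_sym; exact: mix_in.
    have z'z : agree M z z'.
      apply: agree_sym; apply: agree_mix => //.
      move=> i [Mi Ni]; rewrite zw//; symmetry; exact: Gp.
    have ez (A : Type) (h : (I -> bool) -> A) : fsupp M h -> h z = h z'.
      by move=> [D [_ DM hD]]; apply: hD; apply: agree_sub z'z.
    pose w' := mix N w (f z').
    have fw' : agree M (f z') w'.
      apply: agree_sym; apply: agree_mix => // i [Mi Ni].
      have [_ _ _ Ff] := iF; rewrite -Ff//.
      rewrite (half_ext_agree iF (y := p))//; last exact: mix_in.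
      exact: wp.
    have ew (A : Type) (h : (I -> bool) -> A) : fsupp M h -> h (f z') = h w'.
      by move=> [D [_ DM hD]]; apply: hD; apply: agree_sub fw'.
    have [Kfz gfz] := fP _ Pz'.
    exists w'; first by rewrite -ew// -uv// -ez.
    by split; [exact: mix_in|rewrite -ew// hy0// gfz -ez].
  have [w1 vw1 [ww1 e1]] := key _ z1w uz1; have [w2 vw2 [ww2 e2]] := key _ z2w uz2.
  apply/andP; split; apply/asboolP; [exists w1|exists w2] => //.
    by rewrite vw1 e1.
  by rewrite vw2 e2.
(* The triple consists of the center and the support of a box in [v] that misses [K], and of a
   coordinate free in the box. This coordinate lies off [N], so both halves of the box have the same
   projection. *)
pose spec w (t : (I -> bool) * set I * I) := [/\ agree (t.1.2 `&` N) w t.1.1,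
  forall z, agree t.1.2 t.1.1 z -> v z /\ ~ K z, finite_set t.1.2, t.1.2 `<=` M &
  [/\ M t.2, ~ N t.2 & ~ t.1.2 t.2]].
have [h fh hspec] : exists2 h, fsupp (M `&` N) h & forall w, W w -> spec w (h w).
  apply: (@select _ _ _ (fun w t => W w -> spec w t)) => w.
  have [D [fD DMN hD]] := fW; have [Ww|nW] := boolP (W w); last first.
    have [c _] := infinite_setN0 iMN.
    by exists (w, set0, c), D; split=> // y /hD <- /(negP nW).
  have /andP[/andP[/asboolP[z /andP[uz xz] zw] _] _] := Ww.
  have [w1 vw1 w1z] := fibl _ uz.
  have w1w : agree N w1 w.
    apply: (agree_trans w1z); rewrite -[w in agree _ _ w]FG.
    exact: (half_ext_agree iF).
  have nw1 : ~ over_tube M N K w1.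
    move=> [p w1p tp]; apply: (notW _ Ww); exists p => //.
    apply: agree_trans w1p; apply: agree_sym; apply: agree_sub w1w.
    by move=> i [].
  have [Dv [fDv DvM hDv]] := fv.
  have [b [D' [fD' D'M w1b w1b' hb]]] := eK fDv DvM nw1.
  pose d := Dv `|` D'; have fd : finite_set d by rewrite finite_setU.
  have [c [Mc nNc] ndc] := exists_fresh iMN fd.
  have bd : agree (d `&` N) w b.
    move=> i [[Dvi|D'i] Ni]; rewrite -w1w//; first exact: w1b.
    exact: w1b'.
  exists (b, d, c), (D `|` (d `&` N)); split.
  - by rewrite finite_setU; split => //; exact: finite_setI2.
  - rewrite subUset; split => //; apply: setSI; by rewrite subUset.
  - move=> w' ww' _; split => //=.
    + apply: agree_trans bd; apply: agree_sym; apply: agree_sub ww'; by right.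
    + move=> z2 bz; split; last by apply: hb; apply: agree_sub bz; right.
      rewrite -(hDv w1)//; apply: (agree_trans w1b); apply: agree_sub bz; by left.
    + by rewrite subUset.
(* Off [W], [y0] is kept where both halves are due; where only one is due, it takes the whole fiber
   of [v]. *)
pose y w := if W w then
    (if `[< agree (h w).1.2 (h w).1.1 w >] then w (h w).2 else y0 w)
  else X1 w && (y0 w || ~~ X2 w).
have fy : fsupp M y.
  pose k (s : bool * ((I -> bool) * set I * I)) w := if s.1 then
    (if `[< agree s.2.1.2 s.2.1.1 w >] then w s.2.2 else y0 w)
    else X1 w && (y0 w || ~~ X2 w).
  apply: (@fsupp_bind _ _ _ _ (fun w => (W w, h w)) k) => [|w].
    by apply: (fsuppW MNM); apply: fsupp2.
  rewrite /k /=; case Ww : (W w); last first.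
    apply: fsupp_andb; first exact: (fsuppW MNM).
    by apply: fsupp2 => //; apply: fsupp_negb; exact: (fsuppW MNM).
  have [_ _ fd dM [Mc _ _]] := hspec _ Ww.
  apply: (@fsupp_bind _ _ _ _ (fun z => `[< agree (h w).1.2 (h w).1.1 z >])
     (fun t z => if t then z (h w).2 else y0 z)).
    exists (h w).1.2; split; [exact: fd|exact: dM|move=> z z' zz'].
    congr (`[< _ >]); apply/propext.
    by split=> e; apply: (agree_trans e) => //; exact: agree_sym.
  by move=> z; case: asboolP => _ //; exact: fsupp_coord.
have eN z z' : agree N z z' -> [/\ W z = W z', X1 z = X1 z', X2 z = X2 z' & h z = h z'].
  by move=> zz'; split; apply: (fsupp_agree (M := M)) zz'.
have X1F z : u z -> x z -> X1 (F z).
  by move=> uz xz; apply/asboolP; exists z; rewrite ?uz// GF.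
have X2F z : u z -> ~~ x z -> X2 (F z).
  by move=> uz xz; apply/asboolP; exists z; rewrite ?uz// GF.
have hP z : P z -> u z -> y (f z) = x z.
  move=> Pz uz; have [Kfz gfz] := fP _ Pz.
  have zG : agree N z (G (f z)).
    by apply: agree_sym; rewrite -[in X in agree _ _ X]gfz; exact: Gg.
  rewrite /y hy0// gfz; case: ifPn => [Ww|_].
    rewrite asboolF// => /(let: And5 _ e _ _ _ := hspec _ Ww in e)[_]; exact.
  have [xz|xz] := boolP (x z).
    by rewrite andbT; apply/asboolP; exists z; rewrite ?uz.
  rewrite /= (_ : X2 (f z))/= ?andbF//; apply/asboolP; by exists z; rewrite ?uz.
have hW t z : W (F z) -> exists2 w, v w && (y w == t) & agree N w (F z).
  move=> Ww; have [e1 e2 fd dM [Mc nNc ndc]] := hspec _ Ww.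
  pose w := mix N (F z) (upd (h (F z)).2 t (h (F z)).1.1).
  have wF : agree N w (F z) by exact: mix_in.
  have dw : agree (h (F z)).1.2 (h (F z)).1.1 w.
    apply: agree_sym; apply: agree_mix => //.
    apply: agree_sub (agree_sym (upd_agree _ _ ndc)); by move=> i [].
  exists w => //; have [-> _] := e2 _ dw.
  rewrite /y; have [-> _ _ ->] := eN _ _ wF.
  by rewrite Ww asboolT//= /w /mix asboolF// upd_eq.
exists y; split=> //; split; do ?by apply: fsupp_andb => //; exact: fsupp_negb.
- move=> z Pz; rewrite uv//; case vz : (v (f z)) => //=.
  by rewrite hP// uv.
- move=> z /andP[uz xz]; have [Ww|nW] := boolP (W (F z)).
    by have [w] := hW true _ Ww; rewrite eqb_id; exists w.
  have [X2w|nX2] := boolP (X2 (F z)).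
    move: (nW); rewrite /W X1F// X2w /= negbK => /andP[/asboolP[w /andP[vw yw] wF] _].
    exists w => //; rewrite vw /y; have [-> -> _ _] := eN _ _ wF.
    by rewrite (negbTE nW) yw X1F.
  have [w vw wF] := fibl _ uz; exists w => //.
  rewrite vw /y; have [-> -> -> _] := eN _ _ wF.
  by rewrite (negbTE nW) nX2 X1F//= orbT.
- move=> w /andP[vw yw]; have : X1 w.
    by move: yw; rewrite /y; case: ifP => [/andP[/andP[-> _] _]//|_ /andP[]].
  by move=> /asboolP.
- move=> z Pz; rewrite uv//; case vz : (v (f z)) => //=.
  by rewrite hP// uv.
- move=> z /andP[uz xz]; have [Ww|nW] := boolP (W (F z)).
    by have [w] := hW false _ Ww; rewrite eqbF_neg; exists w.
  have [X1w|nX1] := boolP (X1 (F z)).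
    move: (nW); rewrite /W X1w X2F//= negbK => /andP[_ /asboolP[w /andP[vw yw] wF]].
    exists w => //; rewrite vw /y; have [-> -> -> _] := eN _ _ wF.
    by rewrite (negbTE nW) (negbTE yw) X2F//= andbF.
  have [w vw wF] := fibl _ uz; exists w => //.
  rewrite vw /y; have [-> -> -> _] := eN _ _ wF.
  by rewrite (negbTE nW) (negbTE nX1).
- move=> w /andP[vw yw]; have [|nX2] := boolP (X2 w); first by move=> /asboolP.
  have nX1 : ~~ X1 w.
    move: yw; rewrite /y /W (negbTE nX2) andbF /= orbT andbT.
    by [].
  have [z uz zw] := fibr _ vw; exists z => //; rewrite uz /=.
  apply: contra nX1 => xz; apply/asboolP; exists z => //; by rewrite uz.
Qed.

End FiberedStep.

(** The demands to close [M] under. The third one treats all [w] above the condition at once, so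
    that it depends on [y] through [D] only, as [closing_off] requires. *)
Definition fiber_cond (I : Type) (N : set I) (P : set (I -> bool))
    (f F : (I -> bool) -> (I -> bool)) (D : set I) (y : I -> bool) (E : set I) :=
  [/\ supp_in P f D E, supp_in setT F (D `&` N) (E `&` N) &
    (forall w, agree D y w -> ~ tube N P w) ->
    forall w, agree D y w -> exists b D', [/\ finite_set D', D' `<=` E,
      agree D w b, agree (D' `&` N) w b & forall z, agree D' b z -> ~ P z]].

Lemma fiber_cond_exists (I : Type) (N : set I) (P K : set (I -> bool))
    f g F G (D : set I) x :
  half_iso P K f g -> half_ext N P f F G -> half_good N P K f -> finite_set D ->
  exists2 E, finite_set E & forall y, agree D x y -> fiber_cond N P f F D y E.
Proof.
move=> iso ext [good _] fD; have [E1 fE1 hE1] := half_iso_supp_in iso fD.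
have [|i [Di Ni]|E2 fE2 hE2] := @supp_in_exists I setT F (D `&` N).
- exact: finite_setI2.
- have [h _ _ _] := ext; have [D' [fD' _ hD']] := h _ Ni.
  by exists D' => // z z' _ _; exact: hD'.
(* On [N] the map [F] depends on coordinates in [N] only, so supports may be cut down to [N]. *)
have {}hE2 : supp_in setT F (D `&` N) ((E2 `&` N) `&` N).
  move=> i [Di Ni]; have [h _ _ _] := ext; have [D' [fD' D'N hD']] := h _ Ni.
  have [D2 [fD2 D2E hD2]] := hE2 i (conj Di Ni).
  exists (D2 `&` N); split; first exact: finite_setI2.
    by move=> k [/D2E ? ?].
  move=> z z' _ _ zz'; rewrite (hD' z (mix N z z')); last first.
    by apply: (agree_sub D'N); apply: agree_sym; exact: mix_in.
  apply: hD2 => //; apply: agree_mix => //.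
have [E3 fE3 hE3] : exists2 E3, finite_set E3 & forall y, agree D x y ->
    (forall w, agree D y w -> ~ tube N P w) ->
    forall w, agree D y w -> exists b D', [/\ finite_set D', D' `<=` E3,
      agree D w b, agree (D' `&` N) w b & forall z, agree D' b z -> ~ P z].
  have [|/existsNP[w0 /not_implyP[xw0 /contrapT tw0]]] :=
    pselect (forall w, agree D x w -> ~ tube N P w); last first.
    exists set0 => // y xy h; case: (h w0) => //.
    by apply: agree_trans xw0; exact: agree_sym.
  move=> h; pose R w (t : (I -> bool) * set I) := agree D x w ->
    [/\ finite_set t.2, agree D w t.1, agree (t.2 `&` N) w t.1 &
      forall z, agree t.2 t.1 z -> ~ P z].
  (* Each [w] has its own escape [(b, D')]; by compactness finitely many escapes serve all [w], so
     one finite [E3] suffices. *)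
  have [w|s hs] := @cube_compact I _ R.
    have [xw|nw] := pselect (agree D x w); last first.
      exists (w, set0), D; split=> // y wy xy; case: nw.
      by apply: (agree_trans xy); exact: agree_sym.
    have /existsNP[b /not_implyP[wb nPb]] : ~ tube (N `|` D) P w.
      by move=> /(good _ _ fD); exact: h.
    have [clP _ _] := iso; have [D' fD' hD'] := clP _ nPb.
    exists (b, D'), (D `|` (D' `&` N)); split.
      by rewrite finite_setU; split=> //; exact: finite_setI2.
    move=> w' ww' _; split=> //=.
      have ww : agree D w w' by apply: agree_sub ww'; left.
      apply: (agree_trans (agree_sym ww)); apply: agree_sub wb; by right.
    have ww : agree (D' `&` N) w w' by apply: agree_sub ww'; right.
    apply: (agree_trans (agree_sym ww)); apply: agree_sub wb.
    by move=> i []; left.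
  exists (\bigcup_(t in [set t | List.In t s /\ finite_set t.2]) t.2).
    apply: bigcup_finite => [|t []//].
    by apply: sub_finite_set (finite_set_In s) => t [].
  move=> y xy _ w yw; have [[b D'] ts Rt] := hs w.
  have [|/= fD' wb wb' hb] := Rt _; first exact: agree_trans yw.
  by exists b, D'; split=> // i D'i; exists (b, D').
exists (E1 `|` (E2 `&` N) `|` E3).
  by rewrite !finite_setU; do ![split=> //]; exact: finite_setI2.
move=> y xy; split.
- by apply: supp_in_sub hE1 => i ?; left; left.
- by apply: supp_in_sub hE2 => i [E2i Ni]; split=> //; left; right.
- move=> /(hE3 _ xy) h w /h[b [D' [? D'E ? ? ?]]].
  by exists b, D'; split=> // i /D'E; right.
Qed.

Lemma fiber_match_sym (I : Type) (M N : set I) (P K : set (I -> bool)) f g F G u v :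
  half_iso P K f g -> half_iso K P g f ->
  fiber_match M N P f F G u v -> fiber_match M N K g G F v u.
Proof.
move=> [_ fP _] [_ gK _] [fu fv uv h1 h2]; split=> // z Kz.
by have [Pg fg] := gK _ Kz; rewrite uv// fg.
Qed.

Lemma fiber_cond_closed (I : Type) (M N : set I) (P K : set (I -> bool)) f g F G :
  half_iso P K f g -> half_ext N P f F G ->
  (forall D y, finite_set D -> D `<=` M ->
     exists2 E, E `<=` M & fiber_cond N P f F D y E) ->
  [/\ coord_closed M P f, coord_closed (M `&` N) setT F & fiber_escape M N P].
Proof.
move=> iso ext h; split.
- apply: coord_closedP => D fD DM.
  by have [E EM [? _ _]] := h D (fun=> true) fD DM; exists E.
- apply: coord_closedP => D fD DM.
  have [|E EM [_ + _]] := h D (fun=> true) fD; first by move=> i /DM[].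
  rewrite (_ : D `&` N = D); last by apply/seteqP; split=> [i []|i Di]//; split=> //;
    have [] := DM _ Di.
  by exists (E `&` N) => //; apply: setSI.
- move=> w D fD DM nw.
  (* The tubes form a closed set, so having none over [w] is already guaranteed by finitely many
     coordinates of [M] in [N]. *)
  have [||D1 [fD1 D1MN hD1]] := @separation _ (M `&` N) (tube N P) w.
  + by apply: cclosed_tube; have [] := iso.
  + by move=> z tz wz; apply: nw; exists z.
  have fDD : finite_set (D `|` D1) by rewrite finite_setU.
  have [|E EM [_ _ hE]] := h _ w fDD; first by rewrite subUset; split=> // i /D1MN[].
  have [||b [D' [? D'E wb ? ?]]] := hE _ w; last 1 first.
  + exists b, D'; split=> //; first exact: subset_trans EM.
    by apply: agree_sub wb; left.
  + by move=> z wz; apply: hD1; apply: agree_sub wz; right.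
  + by [].
Qed.

Lemma fiber_step (I : Type) (P K : set (I -> bool)) f g N F G (M0 : set I) :
  half_iso P K f g -> half_iso K P g f ->
  half_ext N P f F G -> half_ext N K g G F ->
  half_good N P K f -> half_good N K P g ->
  infinite_set (~` N) -> covers nat M0 ->
  exists M F' G', [/\ M0 `<=` M, covers nat M, half_ext (N `|` M) P f F' G',
    half_ext (N `|` M) K g G' F' &
    (forall x, agree N (F' x) (F x)) /\ (forall x, agree N (G' x) (G x))].
Proof.
move=> isoPK isoKP iF iG goodP goodK iN cM0.
(* Putting [B] into [M] leaves infinitely many coordinates of [M] outside [N] for the splittings. *)
have [B [BN cB iB]] := infinite_countable_subset iN.
pose Q (b : bool) (D : set I) (y : I -> bool) E :=
  if b then fiber_cond N P f F D y E else fiber_cond N K g G D y E.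
have [|||M [M0M cM hM]] := @closing_off nat I bool (M0 `|` B) Q squarable_nat.
- by apply: covers_finite; [exact: squarable_nat|exact: finite_finset].
- by apply: coversU => //; exact: squarable_nat.
- move=> b D x fD; suff [E fE hE] : exists2 E, finite_set E &
      forall y, agree D x y -> Q b D y E.
    by exists E => //; apply: covers_finite fE; exact: squarable_nat.
  by case: b; [exact: fiber_cond_exists isoPK iF goodP fD|
    exact: fiber_cond_exists isoKP iG goodK fD].
have iMN : infinite_set (M `\` N).
  by apply: sub_infinite_set iB => i Bi; split; [apply: M0M; right|exact: BN].
have [cMf cF eP] := fiber_cond_closed isoPK iF (hM true).
have [cMg cG eK] := fiber_cond_closed isoKP iG (hM false).
have [_ fP _] := isoPK; have [_ gK _] := isoKP.
have [_ _ GF _] := iF; have [_ _ FG _] := iG.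
have [|||u v x h fx|u v y h fy|u v h x ux|u v h y vy|u v h z Pz uz|u v h z Kz vz|
    F' [G' [h1 h2 h3 h4]]] := @back_and_forth I P K f g N M F G iF iG
    cM (fiber_match M N P f F G).
- by move=> u v [].
- split=> //; try exact: fsupp_const.
    by move=> x _; exists (F x).
  by move=> x _; exists (G x).
- by split=> //; exact: fsupp_const.
- exact: (fiber_forth isoPK isoKP iF iG cMg cG goodK eK iMN h fx).
- have h' := fiber_match_sym isoPK isoKP h.
  have [x [fx m1 m2]] := fiber_forth isoKP isoPK iG iF cMf cF goodP eP iMN h' fy.
  by exists x; split=> //; exact: (fiber_match_sym isoKP isoPK).
- by have [_ _ _ + _] := h; apply.
- by have [_ _ _ _ +] := h; apply.
- by have [_ _ uv _ _] := h; rewrite -uv.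
- by have [_ _ uv _ _] := h; have [Pg fg] := gK _ Kz; rewrite uv// fg.
by exists M, F', G'; split=> // i M0i; apply: M0M; left.
Qed.

(** * Bookkeeping along an initial well-order *)

Definition interior_pt (I L : Type) (P : set (I -> bool)) (x : I -> bool) : Prop :=
  exists2 D : set I, covers L D & tube D P x.

Lemma tube_sub (I : Type) (D E : set I) (P : set (I -> bool)) x :
  D `<=` E -> tube D P x -> tube E P x.
Proof. by move=> DE h y xy; apply: h; exact: agree_sub xy. Qed.

Lemma interior_pt_covers (I L M : Type) (P : set (I -> bool)) x :
  covers M [set: L] -> interior_pt L P x -> interior_pt M P x.
Proof. by move=> cL [D cD tD]; exists D => //; exact: covers_trans cD. Qed.

(* The set [B] is closed under choosing, for every finite condition on [B] that is
   met by an interior point, the support of one such point. *)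
Lemma interior_support (I L : Type) (P : set (I -> bool)) :
  squarable L -> cclosed P ->
  exists2 B, covers L B & forall x, interior_pt L P x -> tube B P x.
Proof.
move=> sL cP.
pose Q (_ : unit) (D : set I) (y : I -> bool) (E : set I) :=
  forall x, agree D y x -> interior_pt L P x ->
  exists x' D', [/\ D' `<=` E, agree D y x' & tube D' P x'].
have [|||B [_ cB hB]] := @closing_off L I unit set0 Q sL.
- by apply: covers_finite => //; exact: finite_finset.
- exact: covers_finite.
- move=> j D x fD.
  have [[x' [xx' [D' cD' tD']]]|n] := pselect (exists x', agree D x x' /\ interior_pt L P x');
    last first.
    exists set0; first exact: covers_finite.
    move=> y xy x' yx' ix'; case: n; exists x'; split=> //.
    exact: agree_trans yx'.
  exists D' => // y xy _ _ _; exists x', D'; split=> //.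
  by apply: agree_trans xx'; exact: agree_sym.
exists B => // x ix w xw; apply: contrapT => /cP[D0 fD0 hD0].
have [||E EB hE] := hB tt (D0 `&` B) w; [exact: finite_setI2|by move=> i []|].
have [|x' [D' [D'E wx' tx']]] := hE x _ ix; first by move=> i [_ Bi]; rewrite xw.
(* This point agrees with [w] on [D0], which excludes it from [P], and with [x'] on its support,
   which puts it into [P]. *)
apply: (hD0 (mix B x' w)).
  apply: agree_sym; apply: agree_mix; last by move=> i.
  by move=> i Di; rewrite wx'.
apply: tx'; apply: agree_sym; apply: (@agree_sub _ _ B); last exact: mix_in.
exact: subset_trans EB.
Qed.

Lemma covers_sigP (L I : Type) (A : set I) :
  covers L [set: {x | A x}] <-> covers L A.
Proof.
split=> [/(covers_image sval)|[e he]].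
  by apply: covers_sub => x Ax; exists (exist _ x Ax).
apply: (@covers_relP _ _ _ (fun (a : {x | A x}) l => e l = Some (sval a))).
  by move=> [a Aa] _; apply: he.
by move=> a b l _ _ -> [/sval_inj].
Qed.

Lemma covers_id (L : Type) : covers L [set: L].
Proof. by exists Some => l _; exists l. Qed.

Lemma covers_self (I : Type) (A : set I) : covers {x | A x} A.
Proof. by apply/covers_sigP; exact: covers_id. Qed.

Lemma finite_covers_nat (L : Type) : finite_set [set: L] -> covers nat [set: L].
Proof. by apply: covers_finite; exact: squarable_nat. Qed.

Lemma infinite_squarable (I : Type) (A : set I) : ~ covers nat A -> squarable {x | A x}.
Proof.
move=> nA; apply: squarable_infinite => fA; apply: nA.
by apply/covers_sigP; exact: finite_covers_nat.
Qed.

(** The last clause makes the order type an initial ordinal. *)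
Definition initial_well_order (I : Type) (lt : I -> I -> Prop) : Prop :=
  [/\ forall A : set I, A !=set0 -> exists2 a, A a & forall b, A b -> ~ lt b a,
      forall a b c, lt a b -> lt b c -> lt a c,
      forall a b, [\/ lt a b, a = b | lt b a],
      forall a, ~ lt a a &
      forall a, ~ covers {b | lt b a} [set: I]].

(* Any well-order is made initial by transporting it along an injection into a
   shortest segment equipotent to the whole set. *)
Lemma initial_well_orderP (I : Type) : exists lt : I -> I -> Prop, initial_well_order lt.
Proof.
have [R woR] := well_ordering_principle {classic I}.
have Rmin (A : set I) : A !=set0 -> exists2 a, A a & forall b, A b -> R a b.
  move=> [x Ax]; have [|z [[zA hz] _]] := woR [pred x : {classic I} | `[< A x >]].
    by exists x; apply/asboolP.
  exists z; first by move: zA => /asboolP.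
  by move=> b Ab; apply: hz; apply/asboolP.
have Rtot a b : R a b \/ R b a.
  have [|z [->|->] hz] := Rmin [set x | x = a \/ x = b]; first by exists a; left.
    by left; apply: hz; right.
  by right; apply: hz; left.
have Ranti a b : R a b -> R b a -> a = b.
  move=> ab ba; pose A := [pred x : {classic I} | `[< x = a \/ x = b >]].
  have [|z [_ uz]] := woR A; first by exists a; apply/asboolP; left.
  have Rxx x : R x x by have [] := Rtot x x.
  transitivity z; [symmetry|]; apply: uz; split.
  - by apply/asboolP; left.
  - by move=> c /asboolP[->|->].
  - by apply/asboolP; right.
  - by move=> c /asboolP[->|->].
pose lt a b := R a b /\ a <> b.
have ltmin (A : set I) : A !=set0 -> exists2 a, A a & forall b, A b -> ~ lt b a.
  move=> /Rmin[a Aa ha]; exists a => // b /ha ab [ba nba].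
  by apply: nba; exact: Ranti.
have lttrans a b c : lt a b -> lt b c -> lt a c.
  move=> [ab nab] [bc nbc].
  have nac : a <> c by move=> e; apply: nab; apply: Ranti => //; rewrite e.
  split=> //; have [|z zA hz] := Rmin [set x | [\/ x = a, x = b | x = c]].
    by exists a; constructor 1.
  have [ha hb hc] : [/\ R z a, R z b & R z c].
    by split; apply: hz; [constructor 1|constructor 2|constructor 3].
  case: zA => e; subst z => //; first by case: nab; exact: Ranti.
  by case: nbc; exact: Ranti.
have lttot a b : [\/ lt a b, a = b | lt b a].
  have [->|ab] := pselect (a = b); first by constructor 2.
  have [Rab|Rba] := Rtot a b; first by constructor 1.
  by constructor 3; split=> // ba; apply: ab.
have ltirr a : ~ lt a a by case.
have [[a ca]|n] := pselect (exists a, covers {b | lt b a} [set: I]); last first.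
  by exists lt; split=> // a ca; apply: n; exists a.
have [|a0 ca0 ha0] := ltmin [set a | covers {b | lt b a} [set: I]]; first by exists a.
have [l0] : inhabited {b | lt b a0}.
  by have [e he] := ca0; have [l _] := he a0 Logic.I.
have [h hh] := covers_inj l0 ca0.
pose lt' x y := lt (sval (h x)) (sval (h y)).
exists lt'; split.
- move=> A [x Ax].
  have [|b [y Ay yb] hb] := ltmin [set sval (h x) | x in A].
    by exists (sval (h x)), x.
  by exists y => // c Ac; rewrite /lt' yb; apply: hb; exists c.
- by move=> x y z; exact: lttrans.
- move=> x y; have [e|/sval_inj e|e] := lttot (sval (h x)) (sval (h y)).
  + by constructor 1.
  + by constructor 2; apply: hh.
  + by constructor 3.
- by move=> x; exact: ltirr.
- move=> x cx; apply: (ha0 (sval (h x))); last exact: (svalP (h x)).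
  apply: covers_trans cx.
  apply: (@covers_relP _ _ _ (fun y z => sval z = sval (h (sval y)))).
    by move=> [y yx] _; exists (exist _ (sval (h y)) yx).
  by move=> y z l _ _ -> /sval_inj e; apply: sval_inj; apply: hh.
Qed.

Section Bookkeeping.
Variables (I : Type) (lt : I -> I -> Prop).
Hypothesis wo : initial_well_order lt.

Definition seg k : set I := [set b | lt b k].
Definition segT k : Type := {b | seg k b}.
(** These are the positions of the uncountable cardinals below $|I|$; countable interiors are taken
    care of by the first step. *)
Definition initial_pt k : Prop :=
  ~ covers nat (seg k) /\ forall b, lt b k -> ~ covers (segT b) (seg k).

Let ltmin (A : set I) : A !=set0 -> exists2 a, A a & forall b, A b -> ~ lt b a.
Proof. by have [h _ _ _ _] := wo; exact: h. Qed.
Let lttrans a b c : lt a b -> lt b c -> lt a c.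
Proof. by have [_ h _ _ _] := wo; exact: h. Qed.
Let lttot a b : [\/ lt a b, a = b | lt b a].
Proof. by have [_ _ h _ _] := wo; exact: h. Qed.
Let ltirr a : ~ lt a a.
Proof. by have [_ _ _ h _] := wo; exact: h. Qed.

Lemma initial_pt_squarable k : initial_pt k -> squarable (segT k).
Proof. by move=> [nk _]; exact: infinite_squarable. Qed.

Lemma initial_pt_exists a : ~ covers nat (seg a) ->
  exists k, [/\ initial_pt k, k = a \/ lt k a & covers (segT k) (seg a)].
Proof.
move=> na; have [|k ck hk] := ltmin (A := [set k | covers (segT k) (seg a)]).
  by exists a; exact: covers_self.
exists k; split=> //.
  split=> [ck'|b bk cb].
    by apply: na; apply: covers_trans ck; apply/covers_sigP.
  by apply: (hk b) => //; apply: covers_trans ck; apply/covers_sigP.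
have [ka|->|ak] := lttot k a; [by right|by left|].
by case: (hk a) => //; exact: covers_self.
Qed.

(** The segments of [g] and [k] differ by the tail, and the segment of [g] is too small to account
    for the size of that of [k]. *)
Lemma tail_covers g k : initial_pt k -> lt g k ->
  covers {b | lt b k /\ ~ lt b g} (seg k).
Proof.
move=> [nk hk] gk; pose T := [set b | lt b k /\ ~ lt b g].
have kE : seg k `<=` seg g `|` T.
  by move=> b bk; have [bg|nbg] := pselect (lt b g); [left|right].
have nat_sum : covers nat (seg g) -> covers nat T -> False.
  move=> cg cT; apply: nk; apply: covers_sub kE _.
  by apply: coversU => //; exact: squarable_nat.
have [cv|cv] := covers_total {b | T b} (segT g).
  have {}cv : covers {b | T b} (seg g) by apply/covers_sigP.
  have [cT|nT] := pselect (covers nat T).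
    case: nat_sum => //; apply: covers_trans cv; exact/covers_sigP.
  apply: covers_sub kE _; apply: coversU => //; first exact: infinite_squarable.
  exact: covers_self.
have {}cv : covers (segT g) T by apply/covers_sigP.
have [cg|ng] := pselect (covers nat (seg g)).
  case: nat_sum => //; apply: covers_trans cv; exact/covers_sigP.
case: (hk g) => //; apply: covers_sub kE _; apply: coversU => //.
  exact: infinite_squarable.
exact: covers_self.
Qed.

(* Left-discreteness of [J] makes the tails [[g, k)] attached to the points [k]
   of [J] pairwise disjoint, so each point has to serve a single [k]. *)
Lemma bookkeeping (J : set I) (B : I -> set I) :
  (forall k, J k -> initial_pt k /\ covers (segT k) (B k)) ->
  (forall k, J k -> exists2 g, lt g k & forall m, J m -> lt g m -> ~ lt m k) ->
  exists b : I -> set I, (forall a, covers nat (b a)) /\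
    forall k, J k -> B k `<=` \bigcup_(a in seg k) b a.
Proof.
move=> hJ hd.
have /choice[g hg] (k : I) : exists g, J k -> lt g k /\
    forall m, J m -> lt g m -> ~ lt m k.
  by have [/hd[g ? ?]|nJ] := pselect (J k); [exists g|exists k].
pose T k := [set b | lt b k /\ ~ lt b (g k)].
have /choice[h hh] (k : I) : exists h : I -> option I,
    J k -> forall c, B k c -> exists l, T k l /\ h l = Some c.
  have [Jk|nJ] := pselect (J k); last by exists (fun=> None).
  have [ik cB] := hJ _ Jk.
  have [h hh] : covers {b | T k b} (B k).
    apply: covers_trans cB; apply/covers_sigP; apply: tail_covers => //.
    by have [] := hg _ Jk.
  exists (fun l => if pselect (T k l) is left Tl then h (exist _ l Tl) else None).
  move=> _ c /hh[[l Tl] hl]; exists l; split=> //.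
  by case: pselect => // Tl'; rewrite (Prop_irrelevance Tl' Tl).
exists (fun a => [set c | exists k, [/\ J k, T k a & h k a = Some c]]).
split.
  (* The full relation is injective exactly on sets with at most one element: the tails are
     disjoint, so [a] serves a single [k]. *)
  move=> a; apply: (@covers_relP _ _ _ (fun _ _ => True)); first by exists 0.
  move=> c c' _ [k [Jk Tk hk]] [k' [Jk' Tk' hk']] _ _.
  have kk' : k = k'.
    have aux p q : J p -> J q -> T p a -> T q a -> ~ lt p q.
      move=> Jp Jq [ap _] [_ naq] pq; have [gq hq] := hg _ Jq; apply: (hq p) => //.
      have [//|e|gp] := lttot (g q) p; first by case: naq; rewrite e.
      by case: naq; exact: lttrans gp.
    by have [/(aux _ _ Jk Jk' Tk Tk')|//|/(aux _ _ Jk' Jk Tk' Tk)] := lttot k k'.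
  by subst k'; move: hk'; rewrite hk => -[].
move=> k Jk c Bc; have [l [Tl hl]] := hh _ Jk _ Bc.
by exists l; [have [] := Tl|exists k].
Qed.

End Bookkeeping.

(** * Cardinals below the weight and segments *)

Lemma cardinal_ltP (a b : cardinal) :
  cardinal_lt a b <-> covers b [set: a] /\ ~ covers a [set: b].
Proof.
by split=> -[h1 h2]; split; [apply/covers_cardP|move=> /covers_cardP|
  apply/covers_cardP|move=> /covers_cardP].
Qed.

Section Segments.
Variables (I : Type) (lt : I -> I -> Prop).
Hypothesis wo : initial_well_order lt.

Let lttrans a b c : lt a b -> lt b c -> lt a c.
Proof. by have [_ h _ _ _] := wo; exact: h. Qed.
Let lttot a b : [\/ lt a b, a = b | lt b a].
Proof. by have [_ _ h _ _] := wo; exact: h. Qed.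

(** Otherwise all segments below [k] have size at most [g] and a copy of [g] is cofinal in [k], so
    that the segment of [k] has size at most $g \cdot g$. *)
Lemma below_segment (g : cardinal) k : initial_pt lt k -> cardinal_lt g (segT lt k) ->
  exists2 b, lt b k & covers (segT lt b) [set: g].
Proof.
move=> [nk _] /cardinal_ltP[cg ncg]; apply: contrapT => n.
have cgb b : lt b k -> covers g (seg lt b).
  move=> bk; apply/covers_sigP; have [//|cb] := covers_total g (segT lt b).
  by case: n; exists b.
have [l0] : inhabited (segT lt k).
  apply: contrapT => e; apply: nk; exists (fun=> None) => a ak; case: e.
  by constructor; exists a.
have [j hj] := covers_inj l0 cg.
have unb b : lt b k -> exists t : g, ~ lt (sval (j t)) b.
  move=> bk; apply: contrapT => /forallNP h; apply: n; exists b => //.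
  apply: (@covers_relP _ _ _ (fun t l => sval l = sval (j t))).
    by move=> t _; have /contrapT tb := h t; exists (exist (seg lt b) _ tb).
  by move=> t t' l _ _ -> /sval_inj; exact: hj.
have kE : seg lt k `<=` \bigcup_(t in [set: g])
    (seg lt (sval (j t)) `|` [set sval (j t)]).
  move=> b bk; have [t nt] := unb b bk; exists t => //.
  by have [|->|] := lttot b (sval (j t)); [left|right|].
have cover (L : Type) : squarable L -> covers L [set: g] -> covers L (seg lt k).
  move=> sL cL; apply: covers_sub kE _; apply: covers_bigcup => // t _.
  apply: coversU => //; last by apply: covers_finite.
  apply: (covers_trans cL); apply: cgb; exact: (svalP (j t)).
(* A finite [g] is replaced by $\aleph_0$, against the uncountability of the segment. *)
have [fg|ig] := pselect (finite_set [set: g]).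
  by apply: nk; apply: cover; [exact: squarable_nat|exact: finite_covers_nat].
apply: ncg; apply/covers_sigP; apply: cover; last exact: covers_id.
exact: squarable_infinite.
Qed.

Lemma segment_mono b k : lt b k -> covers (segT lt k) (seg lt b).
Proof.
move=> bk; apply: covers_sub (covers_self (seg lt k)).
by move=> a ab; exact: lttrans bk.
Qed.

(** Turns an interval of cardinals below [k] into an interval of points, as needed for
    left-discreteness in [bookkeeping]. *)
Lemma cardinal_gap (g : cardinal) k : initial_pt lt k -> cardinal_lt g (segT lt k) ->
  exists2 b, lt b k & forall m, initial_pt lt m -> lt b m -> lt m k ->
    cardinal_lt g (segT lt m) /\ cardinal_lt (segT lt m) (segT lt k).
Proof.
move=> ik gk; have [b bk cb] := below_segment ik gk; exists b => // m im bm mk.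
split; apply/cardinal_ltP; split.
- by apply: covers_trans cb; apply/covers_sigP; exact: segment_mono.
- move=> /(covers_trans cb) c; have [_ h] := im; apply: (h _ bm).
  exact/covers_sigP.
- by apply/covers_sigP; exact: segment_mono.
- by move=> c; have [_ h] := ik; apply: (h _ mk); exact/covers_sigP.
Qed.

End Segments.

Lemma card_interior_finite (I : Type) (P : set (cantor_cube I)) (L : cardinal) x :
  finite_cardinal L -> card_interior P L x <-> inner P x.
Proof.
move=> fL; rewrite /card_interior /= asboolT//; split=> [/nbhs_agreeP//|[D fD h]].
by apply: filterS (nbhs_agree x fD) => y; exact: h.
Qed.

(** Each of the [L] open sets contributes finitely many coordinates; conversely, fixing [L]
    coordinates intersects [L] subbasic open sets. *)
Lemma card_interior_infinite (I : Type) (P : set (cantor_cube I)) (L : cardinal) x :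
  infinite_cardinal L -> card_interior P L x <-> interior_pt L P x.
Proof.
move=> iL; have sL := squarable_infinite iL.
rewrite /card_interior /= asboolF//; split.
  move=> [Px [H [[F [cF oF ->]] Hx HP]]].
  have /choice[D hD] (U : set (cantor_cube I)) : exists D : set I,
      F U -> finite_set D /\ forall y, agree D x y -> U y.
    have [FU|nF] := pselect (F U); last by exists set0.
    have /nbhs_agreeP[D fD hD] : nbhs (x : cantor_cube I) U.
      by apply: open_nbhs_nbhs; split; [exact: oF|exact: Hx].
    by exists D.
  exists (\bigcup_(U in F) D U).
    apply: covers_bigcup => // [|U FU]; first exact/covers_cardP.
    by apply: covers_finite => //; have [] := hD _ FU.
  move=> y xy; apply: HP => U FU; have [_] := hD _ FU; apply.
  by move=> i Di; apply: xy; exists U.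
move=> [D cD tD]; split; first by apply: tD.
pose O i := [set y : cantor_cube I | y i = x i].
exists (\bigcap_(U in O @` D) U); split.
- exists (O @` D); split => //; first by apply/covers_cardP; exact: covers_image.
  move=> _ [i Di <-]; rewrite openE => y yi.
  apply: filterS (nbhs_agree y (finite_set1 i)) => z yz.
  by rewrite /O /= -yi (yz i).
- by move=> _ [i Di <-].
- by move=> y hy; apply: tD => i Di; rewrite (hy (O i)) //; exists i.
Qed.

(** * The chain of extensions *)

Section Tower.
Variables (I : Type) (lt : I -> I -> Prop) (P K : set (I -> bool)).
Variables (f g F0 G0 : (I -> bool) -> (I -> bool)).
Variables (N0 : set I) (b : I -> set I).
Hypothesis wo : initial_well_order lt.
Hypotheses (isoPK : half_iso P K f g) (isoKP : half_iso K P g f).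
Hypotheses (iF0 : half_ext N0 P f F0 G0) (iG0 : half_ext N0 K g G0 F0).
Hypothesis cb : forall a, covers nat (b a).
Hypothesis ba : forall a, b a a.

Definition tower_set (A : set I) (m : I -> set I) : set I :=
  N0 `|` \bigcup_(a in A) m a.

Hypothesis good_tower : forall a m,
  (forall c, lt c a -> covers nat (m c) /\ b c `<=` m c) ->
  [/\ half_good (tower_set (seg lt a) m) P K f,
      half_good (tower_set (seg lt a) m) K P g &
      infinite_set (~` tower_set (seg lt a) m)].

(** [added] records the sets really adjoined, which [fiber_step] may choose larger than [b a]. They
    are not known beforehand, so [good_tower] speaks of all such choices. *)
Record stage := Stage {
  dom : set I;
  added : I -> set I;
  ext : (I -> bool) -> (I -> bool);
  ext_inv : (I -> bool) -> (I -> bool);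
  dom_down : forall a c, dom a -> lt c a -> dom c;
  addedP : forall a, dom a -> covers nat (added a) /\ b a `<=` added a;
  extP : half_ext (tower_set dom added) P f ext ext_inv;
  ext_invP : half_ext (tower_set dom added) K g ext_inv ext }.

Let supp s := tower_set (dom s) (added s).

Let le (s t : stage) : bool := `[< [/\ dom s `<=` dom t,
  forall a, dom s a -> added s a = added t a,
  forall x, agree (supp s) (ext t x) (ext s x) &
  forall x, agree (supp s) (ext_inv t x) (ext_inv s x)] >].

Let supp_sub s t : dom s `<=` dom t -> (forall a, dom s a -> added s a = added t a) ->
  supp s `<=` supp t.
Proof.
move=> st e i [N0i|[a sa ai]]; first by left.
by right; exists a; [exact: st|rewrite -e].
Qed.

Let leP s t : reflect [/\ dom s `<=` dom t,
  forall a, dom s a -> added s a = added t a,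
  forall x, agree (supp s) (ext t x) (ext s x) &
  forall x, agree (supp s) (ext_inv t x) (ext_inv s x)] (le s t).
Proof. exact: asboolP. Qed.

Let le_supp s t : le s t -> supp s `<=` supp t.
Proof. by move=> /leP[? ? _ _]; exact: supp_sub. Qed.

Let stage0 : exists s : stage, True.
Proof.
have e : tower_set set0 (fun=> set0) = N0.
  by rewrite /tower_set bigcup_set0 setU0.
have h1 : half_ext (tower_set set0 (fun=> set0)) P f F0 G0 by rewrite e.
have h2 : half_ext (tower_set set0 (fun=> set0)) K g G0 F0 by rewrite e.
by exists (@Stage set0 (fun=> set0) F0 G0 (fun _ _ h _ => h)
  (fun a (h : set0 a) => False_ind _ h) h1 h2).
Qed.

Lemma half_ext_union (C : set stage) (S : stage -> set I) (Z : set (I -> bool)) h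
    (E E' : stage -> (I -> bool) -> (I -> bool)) (U : set I)
    (F G : (I -> bool) -> (I -> bool)) :
  (forall s, C s -> half_ext (S s) Z h (E s) (E' s)) ->
  (forall i, U i <-> exists2 s, C s & S s i) ->
  (forall s x, C s -> agree (S s) (F x) (E s x)) ->
  (forall s x, C s -> agree (S s) (G x) (E' s x)) ->
  (forall x i, ~ U i -> F x i = x i) ->
  (forall x i, ~ U i -> G x i = x i) ->
  (forall s x y, C s -> agree (S s) x y -> agree (S s) (E' s x) (E' s y)) ->
  half_ext U Z h F G.
Proof.
move=> hE hU hF hG nF nG lG; split.
- move=> i /hU[s Cs si]; have [fs _ _ _] := hE _ Cs.
  have [D [fD DS hD]] := fs i si; exists D; split=> //.
    by move=> k /DS Sk; apply/hU; exists s.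
  by move=> x y /hD; rewrite !(hF s).
- exact: nF.
- move=> x; apply/funext => i; have [Ui|nU] := pselect (U i); last by rewrite nG ?nF.
  have /hU[s Cs si] := Ui; have [_ _ GF _] := hE _ Cs.
  rewrite (hG s)// -[in RHS](GF x); apply: lG => //; exact: hF.
- move=> x Zx i /hU[s Cs si]; have [_ _ _ e] := hE _ Cs.
  by rewrite (hF s)// e.
Qed.

Let chain_bound (C : set stage) : total_on C le -> exists t, forall s, C s -> le s t.
Proof.
move=> totC; have [[s0 Cs0]|nC] := pselect (exists s, C s); last first.
  by have [t _] := stage0; exists t => s Cs; case: nC; exists s.
pose A := \bigcup_(s in C) dom s.
have /choice[m hm] (a : I) : exists ma, forall s, C s -> dom s a -> ma = added s a.
  have [[s [Cs sa]]|n] := pselect (exists s, C s /\ dom s a); last first.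
    by exists set0 => s Cs sa; case: n; exists s.
  exists (added s a) => t Ct ta.
  by have [/leP[_ -> //]|/leP[_ -> //]] := totC _ _ Cs Ct.
pose U := tower_set A m.
have hU i : U i <-> exists2 s, C s & supp s i.
  split=> [[N0i|[a [s Cs sa] ai]]|[s Cs [N0i|[a sa ai]]]].
  - by exists s0 => //; left.
  - by exists s => //; right; exists a => //; rewrite -(hm _ s).
  - by left.
  - by right; exists a; [exists s|rewrite (hm _ s)].
have glue (e : stage -> (I -> bool) -> (I -> bool)) :
    (forall s t x, C s -> C t -> le s t -> agree (supp s) (e t x) (e s x)) ->
    exists E : (I -> bool) -> (I -> bool),
      (forall s x, C s -> agree (supp s) (E x) (e s x)) /\
      (forall x i, ~ U i -> E x i = x i).
  move=> he.
  have /choice[E hE] (x : I -> bool) : exists y : I -> bool,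
      (forall s, C s -> agree (supp s) y (e s x)) /\ forall i, ~ U i -> y i = x i.
    have /choice[y hy] (i : I) : exists c : bool,
        (forall s, C s -> supp s i -> c = e s x i) /\ (~ U i -> c = x i).
      have [Ui|nU] := pselect (U i); last first.
        by exists (x i); split=> // s Cs si; case: nU; apply/hU; exists s.
      have /hU[s Cs si] := Ui; exists (e s x i); split=> // t Ct ti.
      have [st|ts] := totC _ _ Cs Ct; first by rewrite (he s t).
      by rewrite -(he t s).
    by exists y; split=> [s Cs i si|i]; have [h1 h2] := hy i; [exact: h1|exact: h2].
  by exists E; split=> [s x Cs|x]; have [h1 h2] := hE x; [exact: h1|exact: h2].
have [|E [hE nE]] := glue ext; first by move=> s t x _ _ /leP[].
have [|E' [hE' nE']] := glue ext_inv; first by move=> s t x _ _ /leP[].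
have h1 : half_ext U P f E E'.
  apply: (@half_ext_union C supp P f ext ext_inv) => //.
    by move=> s _; exact: extP.
  by move=> s x y _; exact: (half_ext_agree (ext_invP s)).
have h2 : half_ext U K g E' E.
  apply: (@half_ext_union C supp K g ext_inv ext) => //.
    by move=> s _; exact: ext_invP.
  by move=> s x y _; exact: (half_ext_agree (extP s)).
have dA a c : A a -> lt c a -> A c.
  by move=> [s Cs sa] ca; exists s => //; exact: dom_down ca.
have hA a : A a -> covers nat (m a) /\ b a `<=` m a.
  by move=> [s Cs sa]; rewrite (hm _ s)//; exact: addedP.
exists (@Stage A m E E' dA hA h1 h2) => s Cs; apply/leP; split => /=.
- by move=> a sa; exists s.
- by move=> a sa; rewrite (hm _ s).
- by move=> x; exact: hE.
- by move=> x; exact: hE'.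
Qed.

(** A maximal stage is total: otherwise its domain is the segment of its least missing point, and
    [fiber_step] extends it. *)
Lemma tower_top : exists F G, half_ext setT P f F G /\ half_ext setT K g G F.
Proof.
have [ltmin lttrans lttot ltirr _] := wo.
have [s0 _] := stage0.
have [|||s smax] := @ZL_preorder stage s0 le.
- by move=> s; apply/leP; split.
- move=> r s t rs st; apply/leP; have /leP[st1 st2 st3 st4] := st.
  have rsup := le_supp rs; have /leP[rs1 rs2 rs3 rs4] := rs.
  split; first exact: subset_trans st1.
  - by move=> a ra; rewrite rs2// st2//; exact: rs1.
  - by move=> x; apply: agree_trans (rs3 x); apply: agree_sub rsup _.
  - by move=> x; apply: agree_trans (rs4 x); apply: agree_sub rsup _.
- exact: chain_bound.
have [full|/existsNP[a0 na0]] := pselect (forall a, dom s a).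
  have e : tower_set (dom s) (added s) = setT.
    apply/seteqP; split=> // i _; right; exists i; first exact: full.
    by have [_] := addedP (full i); apply.
  have := extP s; have := ext_invP s; rewrite e => h1 h2.
  by exists (ext s), (ext_inv s).
have [|a na ha] := ltmin (~` dom s); first by exists a0.
have domE : dom s = seg lt a.
  apply/seteqP; split=> c.
    move=> sc; have [//|ca|ac] := lttot c a; first by case: na; rewrite -ca.
    by case: na; exact: dom_down ac.
  by move=> ca; apply: contrapT => nc; exact: (ha c).
have [|gP gK iN] := @good_tower a (added s).
  by move=> c ca; apply: addedP; rewrite domE.
rewrite -domE in gP gK iN.
have [M [F' [G' [bM cM hF hG [eF eG]]]]] :=
  fiber_step isoPK isoKP (extP s) (ext_invP s) gP gK iN (cb a).
pose A := [set c | dom s c \/ c = a].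
pose m c := if pselect (dom s c) is left _ then added s c else M.
have ms c : dom s c -> m c = added s c by move=> sc; rewrite /m; case: pselect.
have ma : m a = M by rewrite /m; case: pselect.
have NE : tower_set (dom s) (added s) `|` M = tower_set A m.
  apply/seteqP; split=> i.
    move=> [[N0i|[c sc ci]]|Mi]; [by left|right|right].
      by exists c; [left|rewrite ms].
    by exists a; [right|rewrite ma].
  move=> [N0i|[c [sc|->] ci]]; first by left; left.
    by left; right; exists c => //; rewrite -ms.
  by right; rewrite -ma.
have dA c d : A c -> lt d c -> A d.
  move=> [sc|->] dc; left; first exact: dom_down dc.
  by rewrite domE.
have hA c : A c -> covers nat (m c) /\ b c `<=` m c.
  by move=> [sc|->]; [rewrite ms//; exact: addedP|rewrite ma].
rewrite NE in hF hG.
have /smax/leP[/(_ a) /= sa _ _ _] : le s (@Stage A m F' G' dA hA hF hG).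
  apply/leP; split=> //=; first by move=> c; left.
  by move=> c sc; rewrite ms.
by case: na; apply: sa; right.
Qed.

End Tower.

(** * Sets of coordinates that determine the interiors *)

(** Adding finitely many coordinates to [N] does not exceed the size [L], so a tube over the larger
    set still consists of [L]-interior points, which [N] detects. *)
Lemma half_good_of (I L : Type) (N : set I) (P K : set (I -> bool)) f :
  squarable L -> covers L N ->
  (forall x, interior_pt L P x -> tube N P x) ->
  (forall x, interior_pt L K x -> tube N K x) ->
  (forall x, P x -> interior_pt L P x -> interior_pt L K (f x)) ->
  half_good N P K f.
Proof.
move=> sL cN hP hK hf; split=> [a D fD tD|w tw].
  apply: hP; exists (N `|` D) => //; apply: coversU => //.
  exact: covers_finite.
by apply: hK; apply: hf; [exact: tw|exists N].
Qed.

Section Determined.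
Variables (I : Type) (lt : I -> I -> Prop) (P K : set (I -> bool)).
Variables (f g : (I -> bool) -> (I -> bool)) (B0 : set I) (b : I -> set I).
Hypothesis wo : initial_well_order lt.
Hypotheses (isoPK : half_iso P K f g) (isoKP : half_iso K P g f).
Hypothesis intPK : forall (L : cardinal) x, infinite_cardinal L -> P x ->
  interior_pt L P x -> interior_pt L K (f x).
Hypothesis intKP : forall (L : cardinal) x, infinite_cardinal L -> K x ->
  interior_pt L K x -> interior_pt L P (g x).
Hypotheses (B0P : forall x, interior_pt nat P x -> tube B0 P x)
           (B0K : forall x, interior_pt nat K x -> tube B0 K x).

Definition upto k : set I := B0 `|` \bigcup_(a in seg lt k) b a.

Hypothesis jump_or_limit : forall k, initial_pt lt k ->
  (exists B, [/\ B `<=` \bigcup_(a in seg lt k) b a,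
      forall x, interior_pt (segT lt k) P x -> tube B P x &
      forall x, interior_pt (segT lt k) K x -> tube B K x]) \/
  forall x E, interior_pt (segT lt k) P x -> finite_set E ->
    exists z (g : cardinal), [/\ agree E x z, infinite_cardinal g,
      cardinal_lt g (segT lt k) & interior_pt g P z].

(** Consider a least failure. A prepared [k] cannot fail; at the others the points of smaller
    interiors are dense in the interior, and the set of tubes is closed. *)
Lemma determined k : initial_pt lt k ->
  (forall x, interior_pt (segT lt k) P x -> tube (upto k) P x) /\
  (forall x, interior_pt (segT lt k) K x -> tube (upto k) K x).
Proof.
have [ltmin lttrans lttot _ _] := wo; have [_ fP _] := isoPK; have [_ gK _] := isoKP.
pose good k := (forall x, interior_pt (segT lt k) P x -> tube (upto k) P x) /\
  (forall x, interior_pt (segT lt k) K x -> tube (upto k) K x).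
move=> ik; apply: contrapT => nk.
have [|{ik nk} k [ik nk] kmin] := ltmin [set k | initial_pt lt k /\ ~ good k].
  by exists k.
have IH m : initial_pt lt m -> lt m k -> good m.
  by move=> im mk; apply: contrapT => nm; apply: (kmin m).
have upm m : lt m k -> upto m `<=` upto k.
  move=> mk i [B0i|[a am ai]]; first by left.
  by right; exists a => //; exact: lttrans mk.
have low (c : cardinal) : infinite_cardinal c -> cardinal_lt c (segT lt k) ->
    (forall x, interior_pt c P x -> tube (upto k) P x) /\
    (forall x, interior_pt c K x -> tube (upto k) K x).
  move=> ic ck; have [d dk cd] := below_segment wo ik ck.
  (* A smaller cardinal is countable, where [B0] serves, or is bounded by an initial point below
     [k]. *)
  have [cnt|ncnt] := pselect (covers nat (seg lt d)).
    have cc : covers nat [set: c] by apply: covers_trans cd; apply/covers_sigP.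
    by split=> x /(interior_pt_covers cc) => [/B0P|/B0K]; apply: tube_sub; left.
  have [m [im md cm]] := initial_pt_exists wo ncnt.
  have mk : lt m k by case: md => [->//|md]; exact: lttrans dk.
  have cc : covers (segT lt m) [set: c] by apply: covers_trans cd; apply/covers_sigP.
  have [h1 h2] := IH _ im mk.
  by split=> x /(interior_pt_covers cc) => [/h1|/h2]; apply: tube_sub; exact: upm.
apply: nk; have [[B [Bb hP hK]]|lim] := jump_or_limit ik.
  by split=> x => [/hP|/hK]; apply: tube_sub => i /Bb; right.
split=> x hx; apply: contrapT.
  have [cP _ _] := isoPK; move=> /(cclosed_tube cP)[D fD hD].
  have [z [c [xz ic ck hz]]] := lim _ _ hx fD.
  by apply: (hD z xz); have [h _] := low _ ic ck; exact: h.
(* Density is available for [P] only: approximate [g x] closely enough in [P] and map the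
   approximation back by [f]. *)
have [cK _ _] := isoKP; move=> /(cclosed_tube cK)[D fD hD].
have Kx : K x by case: hx => E _; apply.
have [Pg fg] := gK _ Kx.
have [E fE hE] := half_iso_supp_in isoPK fD.
have [|z [c [xz ic ck hz]]] := lim (g x) _ _ fE.
  by apply: intKP => // fk; have [nk _] := ik; apply: nk; apply/covers_sigP;
    exact: finite_covers_nat.
have Pz : P z by case: hz => E' _; apply.
apply: (hD (f z)); last by have [_] := low _ ic ck; apply; exact: intPK.
move=> i Di; rewrite -fg; have [D' [_ D'E h]] := hE _ Di.
by apply: h => //; exact: agree_sub xz.
Qed.

End Determined.

(** * Translation from the topological statement, and assembly *)

(** Uniform finite supports come from [select], applied to a relation that is vacuous off the closed
    set [P]. *)
Lemma within_half_iso (I : Type) (P K : set (cantor_cube I))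
    (f g : cantor_cube I -> cantor_cube I) :
  closed P -> (forall x, P x -> K (f x) /\ g (f x) = x) -> {within P, continuous f} ->
  @half_iso I P K f g.
Proof.
move=> cP fP cf; have ccP := closed_cclosed cP; split=> // i.
have [x|h [D [fD _ hD]] hh] :=
    @select I bool setT (fun x c => P x -> f x i = c); last first.
  by exists D => // x y Px Py /hD hxy; rewrite !hh// hxy.
have [Px|nP] := pselect (P x); last first.
  by have [D fD hD] := ccP _ nP; exists true, D; split=> // y /hD.
exists (f x i).
have /subspace_continuousP/(_ x Px) cfx := cf.
have /cfx : nbhs (f x) [set y : cantor_cube I | agree [set i] (f x) y].
  by apply: nbhs_agree; exact: finite_set1.
move=> /nbhs_agreeP[D fD hD]; exists D; split=> // y xy Py.
by rewrite (hD _ xy Py i).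
Qed.

Lemma continuous_fsupp (I : Type) (F : cantor_cube I -> cantor_cube I) :
  (forall i, fsupp setT (fun x : I -> bool => F x i)) -> continuous F.
Proof.
move=> hF x U /nbhs_agreeP[D fD hD].
have /choice[E hE] (i : I) : exists E, finite_set E /\
    forall x y : I -> bool, agree E x y -> F x i = F y i.
  by have [E [fE _ h]] := hF i; exists E.
have fE : finite_set (\bigcup_(i in D) E i).
  by apply: bigcup_finite => // i _; have [] := hE i.
apply: filterS (nbhs_agree x fE) => y xy; apply: hD => i Di.
by have [_] := hE i; apply => k Ek; apply: xy; exists i.
Qed.

Lemma closure_agree (I : Type) (A : set (cantor_cube I)) (x : cantor_cube I) (E : set I) :
  closure A x -> finite_set E -> exists2 z, A z & agree E x z.
Proof. by move=> clx /(nbhs_agree x)/clx[z [Az xz]]; exists z. Qed.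

Lemma full_ext_homeomorphism (I : Type) (P K : set (I -> bool)) f g F G :
  @half_ext I setT P f F G -> half_ext setT K g G F ->
  @homeomorphism_between (cantor_cube I) (cantor_cube I) setT setT F /\
  (forall x, P x -> F x = f x).
Proof.
move=> [cF _ GF Ff] [cG _ FG _]; split; last first.
  by move=> x Px; apply/funext => i; exact: Ff.
exists G; split=> //; apply: continuous_subspaceT; apply: continuous_fsupp => i.
  exact: cF.
exact: cG.
Qed.

Lemma card_interior_sub (I : Type) (P : set (cantor_cube I)) (L : cardinal) x :
  card_interior P L x -> P x.
Proof.
have [fL|iL] := pselect (finite_cardinal L).
  by move=> /(card_interior_finite _ _ fL)[D _]; apply.
by move=> /(card_interior_infinite _ _ iL)[D _]; apply.
Qed.

Lemma finite_setC_covers (I L : Type) (N : set I) : squarable L -> covers L N ->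
  ~ covers L [set: I] -> infinite_set (~` N).
Proof.
move=> sL cN nI fN; apply: nI; rewrite -(setUv N); apply: coversU => //.
exact: covers_finite.
Qed.

Lemma lower_union_interior_pt (I : Type) (P : set (cantor_cube I))
    (L : cardinal) z : squarable L -> lower_union P L z -> interior_pt L P z.
Proof.
move=> sL [c [/cardinal_ltP[cL _]]]; have [fc|ic] := pselect (finite_cardinal c).
  move=> /(card_interior_finite _ _ fc)[D fD hD]; exists D => //.
  exact: covers_finite.
by move=> /(card_interior_infinite _ _ ic) /(interior_pt_covers cL).
Qed.

Theorem theorem1p1 (tau : cardinal) (htau : infinite_cardinal tau)
    (P K : set (cantor_cube tau))
    (hP : closed P) (hPproper : P `<` [set: cantor_cube tau])
    (hK : closed K) (hKproper : K `<` [set: cantor_cube tau])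
    (f : cantor_cube tau -> cantor_cube tau)
    (hf : homeomorphism_between P K f)
    (hdiscrete : Ld_discrete P)
    (hinterior : forall lambda : cardinal,
        f @` card_interior P lambda = card_interior K lambda) :
  exists F : cantor_cube tau -> cantor_cube tau,
    homeomorphism_between [set: cantor_cube tau] [set: cantor_cube tau] F /\
    (forall x, P x -> F x = f x).
Proof.
have [g [fP gK cf cg]] := hf.
have isoPK := within_half_iso hP fP cf.
have isoKP := within_half_iso hK gK cg.
have cP := closed_cclosed hP; have cK := closed_cclosed hK.
have intP (L : cardinal) x : card_interior P L x -> card_interior K L (f x).
  by move=> Px; rewrite -hinterior; exists x.
have intK (L : cardinal) y : card_interior K L y -> card_interior P L (g y).
  rewrite -hinterior => -[x Px <-].
  by have [_ ->] := fP _ (card_interior_sub Px).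
have intPK (L : cardinal) x : infinite_cardinal L -> P x ->
    interior_pt L P x -> interior_pt L K (f x).
  by move=> iL _ hx; apply/card_interior_infinite => //; apply: intP;
    apply/card_interior_infinite.
have intKP (L : cardinal) x : infinite_cardinal L -> K x ->
    interior_pt L K x -> interior_pt L P (g x).
  by move=> iL _ hx; apply/card_interior_infinite => //; apply: intK;
    apply/card_interior_infinite.
(* Any finite cardinal gives the ordinary interior. *)
have fbool : finite_cardinal bool by exact: finite_finset.
have innPK x : P x -> inner P x -> inner K (f x).
  by move=> _ hx; apply/(card_interior_finite _ _ fbool); apply: intP;
    apply/card_interior_finite.
have innKP x : K x -> inner K x -> inner P (g x).
  by move=> _ hx; apply/(card_interior_finite _ _ fbool); apply: intK;
    apply/card_interior_finite.
have nP : exists x, ~ P x.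
  have [_ h] := hPproper; apply: contrapT => n; apply: h => x _.
  by apply: contrapT => nx; apply: n; exists x.
have nK : exists x, ~ K x.
  have [_ h] := hKproper; apply: contrapT => n; apply: h => x _.
  by apply: contrapT => nx; apply: n; exists x.
have inat : infinite_cardinal nat := infinite_nat.
have [BP cBP hBP] := interior_support squarable_nat cP.
have [BK cBK hBK] := interior_support squarable_nat cK.
pose B0 := BP `|` BK.
have cB0 : covers nat B0 by apply: coversU => //; exact: squarable_nat.
have B0P x : interior_pt nat P x -> tube B0 P x.
  by move=> /hBP; apply: tube_sub; left.
have B0K x : interior_pt nat K x -> tube B0 K x.
  by move=> /hBK; apply: tube_sub; right.
(* For countable weight the first step already reaches all coordinates. *)
have [ctau|nctau] := pselect (covers nat [set: tau]).
  have [M [F [G [TM _ hF hG]]]] := first_step isoPK isoKP nP nK innPK innKP htau ctau.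
  have MT : M = setT by apply/seteqP; split.
  by rewrite MT in hF hG; exists F; exact: full_ext_homeomorphism hF hG.
have [N0 [F0 [G0 [BN0 cN0 hF0 hG0]]]] := first_step isoPK isoKP nP nK innPK innKP htau cB0.
have [lt wo] := initial_well_orderP tau.
have isegT k : initial_pt lt k -> infinite_cardinal (segT lt k).
  by move=> [nk _] fk; apply: nk; apply/covers_sigP; exact: finite_covers_nat.
have /choice[B hB] (k : tau) : exists B : set tau, initial_pt lt k ->
    [/\ covers (segT lt k) B, forall x, interior_pt (segT lt k) P x -> tube B P x &
    forall x, interior_pt (segT lt k) K x -> tube B K x].
  have [ik|nik] := pselect (initial_pt lt k); last by exists set0.
  have sk := initial_pt_squarable ik.
  have [B1 c1 h1] := interior_support sk cP.
  have [B2 c2 h2] := interior_support sk cK.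
  exists (B1 `|` B2) => _; split; first exact: coversU.
    by move=> x /h1; apply: tube_sub; left.
  by move=> x /h2; apply: tube_sub; right.
pose J1 := [set k | initial_pt lt k /\ ~ limit_cardinal (segT lt k)].
pose J2 := [set k | initial_pt lt k /\ L_discontinuous P (segT lt k)].
have [||b1 [cb1 hb1]] := @bookkeeping tau lt wo J1 B.
- by move=> k [ik _]; split=> //; have [] := hB _ ik.
- move=> k [ik nl].
  (* A cardinal that is not a limit has some [c] below it with nothing strictly between. *)
  have /existsNP[c /not_implyP[ck nc]] : ~ forall c : cardinal,
      cardinal_lt c (segT lt k) ->
      exists d : cardinal, cardinal_lt c d /\ cardinal_lt d (segT lt k).
    by move=> h; apply: nl; split; [exact: isegT|].
  have [d dk hd] := cardinal_gap wo ik ck; exists d => // m [im _] dm mk.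
  by apply: nc; exists (segT lt m); exact: hd.
have [||b2 [cb2 hb2]] := @bookkeeping tau lt wo J2 B.
- by move=> k [ik _]; split=> //; have [] := hB _ ik.
- move=> k [ik /hdiscrete[c [ck hc]]].
  have [d dk hd] := cardinal_gap wo ik ck; exists d => // m [im Dm] dm mk.
  by have [h1 h2] := hd m im dm mk; exact: (hc _ h1 h2).
pose b a := b1 a `|` b2 a `|` [set a].
have cb a : covers nat (b a).
  have sn := squarable_nat.
  by apply: coversU => //; [exact: coversU|exact: covers_finite].
have ba a : b a a by right.
have det k : initial_pt lt k ->
    (forall x, interior_pt (segT lt k) P x -> tube (upto lt B0 b k) P x) /\
    (forall x, interior_pt (segT lt k) K x -> tube (upto lt B0 b k) K x).
  apply: (@determined tau lt P K f g B0 b wo isoPK isoKP intPK intKP B0P B0K) => {}k ik.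
  have [cB hBP' hBK'] := hB _ ik; have sk := initial_pt_squarable ik.
  have [j1|nj1] := pselect (J1 k).
    left; exists (B k); split=> // i /(hb1 _ j1)[a ak ai].
    by exists a => //; left; left.
  have [j2|nj2] := pselect (J2 k).
    left; exists (B k); split=> // i /(hb2 _ j2)[a ak ai].
    by exists a => //; left; right.
  right => x E hx fE; have ik' := isegT _ ik.
  have lk : limit_cardinal (segT lt k).
    by apply: contrapT => nl; apply: nj1.
  (* This inclusion always holds, so continuity amounts to the reverse one, which puts [x] into the
     closure. *)
  have sub : closure (lower_union P (segT lt k)) `<=` card_interior P (segT lt k).
    move=> y hy; apply/card_interior_infinite => //; exists (B k) => //.
    apply: contrapT => /(cclosed_tube cP)[D fD hD].
    have [z lz yz] := closure_agree hy fD; apply: (hD z yz); apply: hBP'.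
    exact: lower_union_interior_pt lz.
  have xcl : closure (lower_union P (segT lt k)) x.
    apply: contrapT => nx; apply: nj2; split=> //; split=> //.
      by exists x; apply/card_interior_infinite.
    split=> // h; apply: nx; apply: h.
    by apply/card_interior_infinite.
  have [z [c [ck hz]] xz] := closure_agree xcl fE; exists z.
  have [fc|ic] := pselect (finite_cardinal c); last first.
    by exists c; split=> //; apply/card_interior_infinite.
  (* Finite cardinals are raised to $\aleph_0$, still below the uncountable segment. *)
  exists nat; split=> //.
    apply/cardinal_ltP; split; first exact: covers_nat.
    by have [nk _] := ik; move=> /covers_sigP.
  have [D fD hD] := (proj1 (card_interior_finite _ _ fc)) hz.
  by exists D => //; apply: covers_finite fD; exact: squarable_nat.
have [F [G [hF hG]]] : exists F G, half_ext setT P f F G /\ half_ext setT K g G F.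
  apply: (@tower_top tau lt P K f g F0 G0 N0 b) => // a m hm.
  have [ca|nca] := pselect (covers nat (seg lt a)).
    have sn := squarable_nat.
    have cN : covers nat (tower_set N0 (seg lt a) m).
      apply: coversU => //; apply: covers_bigcup => // c ca'.
      by have [] := hm c ca'.
    have tP x : interior_pt nat P x -> tube (tower_set N0 (seg lt a) m) P x.
      by move=> /B0P; apply: tube_sub => i /BN0; left.
    have tK x : interior_pt nat K x -> tube (tower_set N0 (seg lt a) m) K x.
      by move=> /B0K; apply: tube_sub => i /BN0; left.
    split.
    - by apply: (half_good_of sn cN) => // x; exact: (intPK nat).
    - by apply: (half_good_of sn cN) => // x; exact: (intKP nat).
    - exact: (finite_setC_covers sn cN).
  (* [k] is the cardinality of the segment of [a]: it bounds the size of the stage, and the stage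
     contains [upto k] because [k] does not exceed [a]. *)
  have [k [ik ka ck]] := initial_pt_exists wo nca.
  have sk := initial_pt_squarable ik.
  have cN : covers (segT lt k) (tower_set N0 (seg lt a) m).
    apply: coversU => //; first exact: covers_countable.
    apply: covers_bigcup => // c ca'; apply: covers_countable => //.
    by have [] := hm c ca'.
  have [detP detK] := det _ ik.
  have upN : upto lt B0 b k `<=` tower_set N0 (seg lt a) m.
    move=> i [/BN0 N0i|[c kc ci]]; first by left.
    have ac : lt c a.
      have [_ lttrans _ _ _] := wo; case: ka => [<-//|]; exact: lttrans.
    by right; exists c => //; have [_] := hm _ ac; apply.
  split.
  - apply: (half_good_of sk cN) => x.
    + by move=> /detP; exact: tube_sub.
    + by move=> /detK; exact: tube_sub.
    + exact: (intPK (segT lt k) x (isegT _ ik)).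
  - apply: (half_good_of sk cN) => x.
    + by move=> /detK; exact: tube_sub.
    + by move=> /detP; exact: tube_sub.
    + exact: (intKP (segT lt k) x (isegT _ ik)).
  - apply: (finite_setC_covers sk cN).
    by have [_ _ _ _] := wo; apply.
by exists F; exact: full_ext_homeomorphism hF hG.
Qed.
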